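(* Let $G$ be an affine algebraic group over $\Bbbk$ and $X$ an affine $G$-variety. Assume that the action of $G$ on $X$ is unipotent. Then all the orbits of $G$ on $X$ are closed. Moreover, if the action is separable, all the orbits are of the form $G/H$ where $H$ is a unipotent closed subgroup of $G$.
   Context: $\Bbbk$ is an algebraically closed field; all algebras are commutative. Geometric actions are on the right: an affine $G$-variety is an affine variety $X$ with a regular right action of $G$, and then $\Bbbk[X]$ is a rational $G$-module algebra via $(g\cdot f)(x)=f(x\cdot g)$. For a rational $G$-module algebra $R$ (commutative $\Bbbk$-algebra and rational $G$-module with $G$ acting by algebra automorphisms), a $(G,R)$-module is a rational $G$-module $M$ that is also an $R$-module with $x\cdot(rm) = (x\cdot r)(x\cdot m)$; ${}^G M$ is the set of $G$-fixed elements. The action of $G$ on $R$ is unipotent if ${}^G M\neq 0$ for every $(G,R)$-module $M\neq 0$; the action of $G$ on $X$ is unipotent if the action of $G$ on $\Bbbk[X]$ is unipotent. The action is separable if for every $x\in X$ the orbit morphism $G\to x\cdot G$ is separable (so that the orbit of $x$ is $G$-equivariantly isomorphic to the homogeneous space of $G$ by the isotropy subgroup of $x$). ''Of the form $G/H$'' means $G$-equivariantly isomorphic to the homogeneous space of $G$ by the closed subgroup $H$. *)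

(* Defs.v *)
From HB Require Import structures.
From mathcomp Require Import all_boot all_order all_algebra.
From mathcomp Require Import boolp classical_sets functions.

Set Implicit Arguments.
Unset Strict Implicit.
Unset Printing Implicit Defensive.

Import GRing.Theory.
Local Open Scope classical_set_scope.
Local Open Scope ring_scope.

(** * Affine varieties *)

Definition subalgebra (k : closedFieldType) (T : Type) (A : {pred T -> k}) :=
  subring_closed A /\ forall c : k, cst c \in A.

(** An affine variety is a set of points together with a finitely generated
    algebra of [k]-valued functions that separates the points and whose
    [k]-algebra morphisms to [k] are all evaluations at points; equivalently, up
    to isomorphism, a Zariski closed subset of some [k^n] with the restrictions
    of the polynomials.  It may be empty or reducible. *)
HB.mixin Record isAffineVariety (k : closedFieldType) (T : Type) := {
  regular : {pred T -> k};
  regular_subalgebra : subalgebra regular;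
  regular_fin_gen : exists s : seq (T -> k),
    {subset s <= regular} /\
    forall A : {pred T -> k},
      subalgebra A -> {subset s <= A} -> {subset regular <= A};
  regular_separates : forall x y : T,
    {in regular, forall f, f x = f y} -> x = y;
  (* only the restriction of [chi] to the regular functions matters *)
  regular_point : forall chi : (T -> k) -> k,
    {in regular &, {morph chi : f g / f + g}} ->
    {in regular &, {morph chi : f g / f * g}} ->
    (forall c : k, chi (cst c) = c) ->
    exists x : T, {in regular, forall f, chi f = f x}
}.

#[short(type="affineVarietyType")]
HB.structure Definition AffineVariety (k : closedFieldType) :=
  { T of isAffineVariety k T }.

Arguments regular {k s}.

Section CoordinateRing.
Variables (k : closedFieldType) (X : affineVarietyType k).

(** The coordinate ring [k[X]]. It is the zero ring when [X] is empty, hence the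
    use of [comPzRingType]; the [k]-algebra structure is the ring morphism
    [coord_const]. *)
Record coordRing := CoordRing {
  coordRing_fun :> X -> k;
  coordRingP : coordRing_fun \in regular
}.

HB.instance Definition _ := [isSub for coordRing_fun].
HB.instance Definition _ := [Choice of coordRing by <:].
HB.instance Definition _ :=
  GRing.SubChoice_isSubComPzRing.Build (X -> k) regular coordRing
    (proj1 (@regular_subalgebra k X)).

Definition coord_const (c : k) : coordRing :=
  CoordRing (proj2 (@regular_subalgebra k X) c).

Lemma coord_const_is_zmod_morphism : zmod_morphism coord_const.
Proof. by move=> a b; apply: val_inj; apply/funext. Qed.

Lemma coord_const_is_monoid_morphism : monoid_morphism coord_const.
Proof. by split=> [|a b]; apply: val_inj; apply/funext. Qed.

HB.instance Definition _ :=
  GRing.isZmodMorphism.Build k coordRing coord_const coord_const_is_zmod_morphism.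
HB.instance Definition _ :=
  GRing.isMonoidMorphism.Build k coordRing coord_const
    coord_const_is_monoid_morphism.

Definition zclosed (A : set X) :=
  exists S : set coordRing, A = [set x | forall f, S f -> f x = 0].

Definition zopen (U : set X) := zclosed (~` U).

Definition irreducible_subset (Z : set X) :=
  Z !=set0 /\ forall A B, zclosed A -> zclosed B ->
    Z `<=` A `|` B -> Z `<=` A \/ Z `<=` B.

Definition irreducible_component (Z : set X) :=
  [/\ zclosed Z, irreducible_subset Z &
      forall Z', zclosed Z' -> irreducible_subset Z' -> Z `<=` Z' -> Z' `<=` Z].

End CoordinateRing.

Arguments coordRing {k} X.
Arguments coord_const {k} X.
Arguments zclosed {k X}.

Section Morphisms.
Variables (k : closedFieldType) (X Y : affineVarietyType k).

Definition regular_map (phi : X -> Y) :=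
  forall f : coordRing Y, f \o phi \in (regular : {pred X -> k}).

Definition comorphism (phi : X -> Y) (hphi : regular_map phi) (f : coordRing Y) :
  coordRing X := CoordRing (hphi f).

(** [F] is a regular function on the product variety, whose coordinate ring is
    the tensor product of [k[X]] and [k[Y]]. *)
Definition regular2 (F : X -> Y -> k) :=
  exists s : seq (coordRing X * coordRing Y),
    forall x y, F x y = \sum_(p <- s) p.1 x * p.2 y.

Lemma regular2_slice (F : X -> Y -> k) (y : Y) :
  regular2 F -> (F^~ y) \in (regular : {pred X -> k}).
Proof.
case=> s Fs; pose S : coordRing X := \sum_(p <- s) p.1 * coord_const X (p.2 y).
suff -> : F^~ y = val S by exact: coordRingP.
by rewrite /S raddf_sum; apply/funext=> x; rewrite Fs fct_sumE.
Qed.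

Lemma regular2_slicel (F : X -> Y -> k) (x : X) :
  regular2 F -> F x \in (regular : {pred Y -> k}).
Proof.
case=> s Fs; pose S : coordRing Y := \sum_(p <- s) coord_const Y (p.1 x) * p.2.
suff -> : F x = val S by exact: coordRingP.
by rewrite /S raddf_sum; apply/funext=> y; rewrite Fs fct_sumE.
Qed.

End Morphisms.

(** * Affine algebraic groups and their actions *)

HB.mixin Record isAffineGroup (k : closedFieldType) (G : Type)
    of Group G & isAffineVariety k G := {
  mulg_regular : forall f : coordRing G, regular2 (fun g h : G => f (g * h)%g);
  invg_regular : regular_map (fun g : G => g^-1%g)
}.

#[short(type="affineGroupType")]
HB.structure Definition AffineGroup (k : closedFieldType) :=
  { G of Group G & isAffineVariety k G & isAffineGroup k G }.

(** Regular right actions. *)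
Record regular_action (k : closedFieldType) (G : affineGroupType k)
    (X : affineVarietyType k) := RegularAction {
  reg_act :> X -> G -> X;
  reg_act1 : forall x, reg_act x 1%g = x;
  reg_actM : forall x g h, reg_act x (g * h)%g = reg_act (reg_act x g) h;
  act_regular : forall f : coordRing X, regular2 (fun x g => f (reg_act x g))
}.

Section Action.
Variables (k : closedFieldType) (G : affineGroupType k).
Variables (X : affineVarietyType k) (a : regular_action G X).

Definition action_orbit (x : X) : set X := [set a x g | g in [set: G]].

Lemma translation_regular (g : G) : regular_map (a^~ g).
Proof. by move=> f; apply: (regular2_slice g (act_regular a f)). Qed.

Lemma orbit_map_regular (x : X) : regular_map (a x).
Proof. by move=> f; apply: (regular2_slicel x (act_regular a f)). Qed.

(** [(g . f) x = f (x . g)] *)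
Definition coord_act (g : G) : coordRing X -> coordRing X :=
  comorphism (translation_regular g).

End Action.

Definition right_mul_action (k : closedFieldType) (G : affineGroupType k) :
  regular_action G G :=
  @RegularAction k G G (fun g h => g * h)%g (@mulg1 G) (@mulgA G)
    (@mulg_regular k G).

(** * Unipotent groups *)

Section Subgroups.
Variables (k : closedFieldType) (G : affineGroupType k).

Record closed_subgroup (H : set G) : Prop := {
  subgroup1 : H 1%g;
  subgroupM : forall g h, H g -> H h -> H (g * h)%g;
  subgroupV : forall g, H g -> H g^-1%g;
  subgroup_closed : zclosed H
}.

(** [g] is unipotent when the translation by [g] is a locally unipotent operator
    of [k[G]]. *)
Definition unipotent_element (g : G) :=
  forall f : coordRing G, exists n : nat,
    iter n (fun u => coord_act (right_mul_action G) g u - u) f = 0.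

Definition unipotent_subgroup (H : set G) :=
  forall g, H g -> unipotent_element g.

End Subgroups.

(** * Rational modules and unipotent actions *)

(** A rational [G]-module is the union of its finite dimensional [G]-stable
    subspaces on which [G] acts by a matrix of regular functions. *)
Record rational_module (k : closedFieldType) (G : affineGroupType k)
    (V : lmodType k) (ga : G -> V -> V) : Prop := {
  rat_linear : forall g, linear (ga g);
  rat_act1 : forall v, ga 1%g v = v;
  rat_actM : forall g h v, ga (g * h)%g v = ga g (ga h v);
  rat_locally_finite : forall v, exists n (e : 'I_n -> V)
      (m : 'I_n -> 'I_n -> coordRing G),
    [/\ forall c : 'I_n -> k, \sum_i c i *: e i = 0 -> forall i, c i = 0,
        exists c : 'I_n -> k, v = \sum_i c i *: e i &
        forall g j, ga g (e j) = \sum_i m i j g *: e i]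
}.

Definition restrict_scalars (k R : pzRingType) (iota : {rmorphism k -> R})
  (M : lmodType R) : Type := M.

Section RestrictionOfScalars.
Variables (k R : pzRingType) (iota : {rmorphism k -> R}) (M : lmodType R).

Notation N := (restrict_scalars iota M).

HB.instance Definition _ := GRing.Zmodule.on N.

Let scale (c : k) (m : N) : N :=
  iota c *: (m : M).

Let scaleA c d m : scale c (scale d m) = scale (c * d) m.
Proof. by rewrite /scale scalerA rmorphM. Qed.
Let scale1 : left_id 1 scale.
Proof. by move=> m; rewrite /scale rmorph1 scale1r. Qed.
Let scaleDr : right_distributive scale +%R.
Proof. by move=> c m n; rewrite /scale scalerDr. Qed.
Let scaleDl m : {morph scale^~ m : c d / c + d}.
Proof. by move=> c d; rewrite /scale rmorphD scalerDl. Qed.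

HB.instance Definition _ :=
  GRing.Zmodule_isLmodule.Build k N scaleA scale1 scaleDr scaleDl.

End RestrictionOfScalars.

Section UnipotentAction.
Variables (k : closedFieldType) (G : affineGroupType k).
(** [R] is meant to be a [k]-algebra through [iota] and a rational [G]-module
    algebra for [actR]; this is not imposed, being automatic for [k[X]], the only
    case used. *)
Variables (R : comPzRingType) (iota : {rmorphism k -> R}) (actR : G -> R -> R).

Record GR_module (M : lmodType R) (ga : G -> M -> M) : Prop := {
  GR_rational : @rational_module k G (restrict_scalars iota M) ga;
  GR_scale : forall g (r : R) (m : M), ga g (r *: m) = actR g r *: ga g m
}.

Definition unipotent_algebra_action :=
  forall (M : lmodType R) (ga : G -> M -> M), GR_module ga ->
    (exists m : M, m != 0) -> exists m : M, m != 0 /\ forall g, ga g m = m.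

End UnipotentAction.

Definition unipotent_action (k : closedFieldType) (G : affineGroupType k)
    (X : affineVarietyType k) (a : regular_action G X) :=
  unipotent_algebra_action (coord_const X) (coord_act a).

(** * Separable morphisms *)

Section Separability.

Definition independent_over (K : fieldType) (F : set K) n (u : 'I_n -> K) :=
  forall c : 'I_n -> K, (forall i, F (c i)) ->
    \sum_i c i * u i = 0 -> forall i, c i = 0.

(** The (not necessarily algebraic) extension [K] of the subfield [F] is
    separable: in characteristic [p > 0], the [p]-th powers of any elements of
    [K] that are linearly independent over [F] are again linearly independent
    over [F]. *)
Definition separable_extension (K : fieldType) (F : set K) :=
  forall p : nat, p \in [pchar K] -> forall n (u : 'I_n -> K),
    independent_over F u -> independent_over F (fun i => u i ^+ p).

Variables (k : closedFieldType) (X Y : affineVarietyType k).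

(** [i] presents [K] as the function field of the irreducible closed subset [Z],
    i.e. as the fraction field of the coordinate ring [k[X] / I(Z)] of [Z]. *)
Definition function_field (Z : set X) (K : fieldType)
    (i : {rmorphism coordRing X -> K}) :=
  (forall f : coordRing X, i f = 0 <-> forall x, Z x -> f x = 0) /\
  (forall u : K, exists f g : coordRing X, i g != 0 /\ u = i f / i g).

(** The image in the function field of [Z] of the function field of the closure
    of [phi Z]; a function on this closure is nonzero iff its pullback to [Z]
    is. *)
Definition pullback_field (phi : X -> Y) (hphi : regular_map phi)
    (K : fieldType) (i : {rmorphism coordRing X -> K}) : set K :=
  [set u | exists f g : coordRing Y,
    i (comorphism hphi g) != 0 /\
    u = i (comorphism hphi f) / i (comorphism hphi g)].

(** Separability of [phi] as a dominant morphism to the closure of its image: on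
    each irreducible component of [X] the extension of function fields is
    separable. *)
Definition separable_map (phi : X -> Y) (hphi : regular_map phi) :=
  forall Z : set X, irreducible_component Z ->
    exists (K : fieldType) (i : {rmorphism coordRing X -> K}),
      function_field Z i /\ separable_extension (pullback_field hphi i).

End Separability.

Definition separable_action (k : closedFieldType) (G : affineGroupType k)
    (X : affineVarietyType k) (a : regular_action G X) :=
  forall x : X, separable_map (orbit_map_regular a x).

(** * Spaces with functions and homogeneous spaces *)

(** A topological space with a sheaf of [k]-valued functions. [is_reg U f] means
    that the restriction of [f] to the open set [U] is regular on [U]; the values
    of [f] outside [U] are irrelevant. *)
Record fun_space (k : closedFieldType) := FunSpace {
  space_point :> Type;
  is_open : set (set space_point);
  is_reg : set space_point -> set (space_point -> k)
}.

Section Spaces.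
Variable k : closedFieldType.

Definition space_morphism (S T : fun_space k) (phi : S -> T) :=
  forall V : set T, is_open V ->
    is_open (phi @^-1` V) /\
    forall f : T -> k, is_reg V f -> is_reg (phi @^-1` V) (f \o phi).

Definition space_isomorphism (S T : fun_space k) (phi : S -> T) :=
  exists psi : T -> S, [/\ cancel phi psi, cancel psi phi,
    space_morphism phi & space_morphism psi].

Definition variety_space (X : affineVarietyType k) : fun_space k :=
  @FunSpace k X (@zopen k X) (fun U => [set f | forall x, U x ->
    exists (V : set X) (u v : coordRing X), [/\ zopen V, V x, V `<=` U &
      forall y, V y -> v y != 0 /\ f y = u y / v y]]).

Definition restrict_space (T : fun_space k) (A : set T) : fun_space k :=
  @FunSpace k {x : T | A x}
    [set U | exists2 V : set T, is_open V & U = [set z | V (sval z)]]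
    (fun U => [set f | forall z, U z ->
      exists (V : set T) (h : T -> k), [/\ is_open V, V (sval z), is_reg V h &
        forall w, U w -> V (sval w) -> f w = h (sval w)]]).

Section Homogeneous.
Variables (G : affineGroupType k) (H : set G).

(** The action being on the right, the homogeneous space of [G] by [H] is the
    space of cosets [H g]. *)
Definition right_coset (g : G) : set G := [set h * g | h in H]%g.

Definition coset_space : Type := {A : set G | exists g, A = right_coset g}.

Definition coset_proj (g : G) : coset_space :=
  exist _ (right_coset g) (ex_intro _ g erefl).

Definition homogeneous_space : fun_space k :=
  @FunSpace k coset_space
    [set U | zopen (coset_proj @^-1` U)]
    (fun U => [set f : coset_space -> k |
      @is_reg k (variety_space G) (coset_proj @^-1` U) (f \o coset_proj)]).

End Homogeneous.

Section Orbits.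
Variables (G : affineGroupType k) (X : affineVarietyType k).
Variable a : regular_action G X.

Definition orbit_space (x : X) : fun_space k :=
  @restrict_space (variety_space X) (action_orbit a x).

(** [G] acts on the cosets by [(H g) . b = H (g * b)]. *)
Definition orbit_iso_homogeneous (x : X) (H : set G) :=
  exists phi : homogeneous_space H -> orbit_space x,
    space_isomorphism phi /\
    forall g b : G,
      sval (phi (coset_proj H (g * b)%g)) = a (sval (phi (coset_proj H g))) b.

End Orbits.
End Spaces.

(* Main.v *)
(* The coordinate ring k[Z] of the closure Z of an orbit x.G embeds in k[G].  By
   unipotence a nonzero G-stable k[Z]-submodule of k[G] contains a nonzero
   function fixed by G, hence 1.  It follows, adjoining fixed points of quotients
   one at a time, that k[G] is free over every G-stable subalgebra S containing
   k[Z], with 1 in a basis; so each maximal ideal of S generates a proper ideal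
   of k[G] and, by the Nullstellensatz, each character of S is the evaluation at a
   point of G.  For S = k[Z] this says that x.G = Z.

   Let H be the isotropy group of x.  If a left H-invariant f in k[G] is not in
   k[Z], one can choose it fixed by G modulo k[Z].  The characters of k[Z][f]
   being points of G, f has a minimal polynomial over k[Z] all of whose
   specializations are powers of linear polynomials, so some f^q is in k[Z] with
   q = 1 or q a power of the characteristic; this contradicts separability.  Hence
   the invariants are k[Z].  Freeness of k[G] over k[Z] shows that the orbit map is
   open, and regular functions descend because the invariants are k[Z].

   H is unipotent: if V' is a proper H-stable subspace of k[G], the induced
   (G, k[X])-module of maps G -> k[G]/V' is nonzero, and a fixed element of it is a
   nonzero H-fixed vector of k[G]/V'. *)

From HB Require Import structures.
Require Import Defs.
From mathcomp Require Import all_boot all_order all_algebra.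
From mathcomp Require Import boolp classical_sets functions.
From mathcomp Require Import ring.

Set Implicit Arguments.
Unset Strict Implicit.
Unset Printing Implicit Defensive.

Import GRing.Theory.
Local Open Scope classical_set_scope.
Local Open Scope ring_scope.

(** * Prime ideals and the Nullstellensatz *)

(** [Zorn_bigcup] is applied to the sets whose union with [A0] satisfies [P]; the empty chain is
    then covered by [P A0], and only nonempty chains of sets above [A0] remain. *)
Lemma Zorn_above T (P : set (set T)) (A0 : set T) :
  P A0 ->
  (forall F : set (set T), F !=set0 -> F `<=` P ->
     (forall A, F A -> A0 `<=` A) -> total_on F subset ->
     P (\bigcup_(A in F) A)) ->
  exists A, [/\ P A, A0 `<=` A & forall B, P B -> A `<=` B -> B `<=` A].
Proof.
move=> PA0 Pchain.
have [|A [PA Amax]] := @Zorn_bigcup T [set E | P (A0 `|` E)].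
  move=> F FP Ftot /=.
  have [->|/set0P F0] := eqVneq F set0; first by rewrite bigcup_set0 setU0.
  rewrite -bigcupUr //.
  have -> : \bigcup_(i in F) (A0 `|` i) =
      \bigcup_(B in [set A0 `|` E | E in F]) B by rewrite bigcup_image.
  apply: Pchain.
  - by case: F0 => E FE; exists (A0 `|` E), E.
  - by move=> _ [E FE <-]; apply: FP.
  - by move=> _ [E FE <-]; left.
  - move=> _ _ [E FE <-] [E' FE' <-].
    by case: (Ftot _ _ FE FE') => EE'; [left|right]; apply: setUS.
exists (A0 `|` A); split=> // B PB AB.
apply: contrapT => BA.
have BE : A0 `|` B = B by apply/setUidPr; apply: subset_trans AB.
apply: (Amax B); last by rewrite /= BE.
split; last by apply: contra_not BA => BA; apply: subset_trans BA _; right.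
by apply: subset_trans AB; right.
Qed.

Section PrimeIdeals.
Variable R : comPzRingType.

Record ideal (I : set R) : Prop := {
  ideal0 : I 0;
  idealD : forall x y, I x -> I y -> I (x + y);
  idealM : forall r x, I x -> I (r * x)
}.

Record prime_ideal (P : set R) : Prop := {
  prime_is_ideal : ideal P;
  prime1 : ~ P 1;
  primeM : forall x y, P (x * y) -> P x \/ P y
}.

Lemma idealB I x y : ideal I -> I x -> I y -> I (x - y).
Proof. by move=> iI Ix Iy; apply: idealD=> //; rewrite -mulN1r; apply: idealM. Qed.

Lemma ideal_sum I (J : Type) (s : seq J) (F : J -> R) :
  ideal I -> (forall j, I (F j)) -> I (\sum_(j <- s) F j).
Proof.
by move=> iI IF; elim/big_rec: _ => [|j x _]; [apply: ideal0|apply: idealD].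
Qed.

Lemma primeX P x n : prime_ideal P -> P (x ^+ n) -> P x.
Proof.
move=> pP; elim: n => [|n IHn]; first by move/(prime1 pP).
by rewrite exprS => /(primeM pP)[].
Qed.

Lemma ideal_bigcup (F : set (set R)) :
  F !=set0 -> (forall I, F I -> ideal I) -> total_on F subset ->
  ideal (\bigcup_(I in F) I).
Proof.
move=> [I0 FI0] Fid Ftot; split.
- by exists I0 => //; apply: ideal0; apply: Fid.
- move=> x y [I FI Ix] [J FJ Jy].
  case: (Ftot _ _ FI FJ) => [/(_ _ Ix) Jx|/(_ _ Jy) Iy].
    by exists J => //; apply: idealD => //; apply: Fid.
  by exists I => //; apply: idealD => //; apply: Fid.
- by move=> r x [I FI Ix]; exists I => //; apply: idealM => //; apply: Fid.
Qed.

(** An ideal maximal among those that contain [I] and avoid the multiplicative set [M] is prime: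
    with any element outside it, it generates an ideal that meets [M]. *)
Lemma exists_prime (I M : set R) :
  ideal I -> M 1 -> (forall x y, M x -> M y -> M (x * y)) ->
  (forall x, I x -> ~ M x) ->
  exists P, [/\ prime_ideal P, I `<=` P & forall x, P x -> ~ M x].
Proof.
move=> iI M1 MM IM.
have [//||P [[iP PM] IP Pmax]] :=
  @Zorn_above _ [set J | ideal J /\ forall x, J x -> ~ M x] I.
  move=> F F0 FP _ Ftot; split; last by move=> x [J /FP[_ ]]; apply.
  by apply: ideal_bigcup => // J /FP[].
exists P; split=> //; split=> // [/PM//|x y Pxy].
apply: contrapT => /not_orP[nPx nPy].
have main z : ~ P z -> exists p r, P p /\ M (p + r * z).
  move=> nPz; apply: contrapT => nM.
  pose J := [set w | exists p r, P p /\ w = p + r * z].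
  have PJ : P `<=` J by move=> p Pp; exists p, 0; rewrite mul0r addr0.
  apply: nPz; apply: (Pmax J) => //; last first.
    by exists 0, 1; rewrite mul1r add0r; split=> //; apply: ideal0.
  split; last by move=> w [p [r [Pp ->]]] Mw; apply: nM; exists p, r.
  split; first by apply: PJ; apply: ideal0.
    move=> _ _ [p [r [Pp ->]]] [q [s [Pq ->]]]; exists (p + q), (r + s).
    by split; [apply: idealD|ring].
  move=> t _ [p [r [Pp ->]]]; exists (t * p), (t * r).
  by split; [apply: idealM|ring].
have [p [r [Pp Mx]]] := main x nPx; have [q [s [Pq My]]] := main y nPy.
apply: (PM _ _ (MM _ _ Mx My)).
have -> : (p + r * x) * (q + s * y) =
  (q + s * y) * p + (r * x * q + r * s * (x * y)) by ring.
apply: idealD => //; first exact: idealM.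
by apply: idealD => //; apply: idealM.
Qed.

(** Zorn's lemma is applied to complements of primes: the union of a chain of complements is the
    complement of an intersection of a chain of primes, which is prime. *)
Lemma exists_minimal_prime (P0 : set R) : prime_ideal P0 ->
  exists P, [/\ prime_ideal P, P `<=` P0 &
    forall Q, prime_ideal Q -> Q `<=` P -> P `<=` Q].
Proof.
move=> pP0.
have [||A [pA A0 Amax]] := @Zorn_above _ [set A | prime_ideal (~` A)] (~` P0).
- by rewrite /= setCK.
- move=> F [A1 FA1] Fp _ Ftot /=; rewrite setC_bigcup; split.
  + split=> [A /Fp pA|x y Ix Iy A FA|r x Ix A FA].
    * exact: ideal0 (prime_is_ideal pA).
    * by apply: (idealD (prime_is_ideal (Fp _ FA))); [apply: Ix|apply: Iy].
    * by apply: (idealM (prime_is_ideal (Fp _ FA))); apply: Ix.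
  + by move/(_ _ FA1); apply: prime1 (Fp _ FA1).
  + move=> x y Ixy; apply: contrapT => /not_orP[/existsNP[A /not_implyP[FA nAx]]].
    move=> /existsNP[B /not_implyP[FB nBy]].
    have [C [FC nCx nCy]] : exists C, [/\ F C, C x & C y].
      have Ax := contrapT nAx; have By := contrapT nBy.
      case: (Ftot _ _ FA FB) => AB; first by exists B; split=> //; apply: AB.
      by exists A; split=> //; apply: AB.
    by case: (primeM (Fp _ FC) (Ixy _ FC)).
exists (~` A); split=> //; first by rewrite -(setCK P0); apply: subsetC.
move=> Q pQ QA x Ax; apply: contrapT => Qx; apply: Ax.
apply: (Amax (~` Q)) => //; first by rewrite /= setCK.
by rewrite -(setCK A); apply: subsetC.
Qed.

(* In a reduced ring the localization at a minimal prime is a field. *)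
Lemma minimal_prime_annihilator (P : set R) r :
  (forall x n, x ^+ n = 0 :> R -> x = 0) ->
  prime_ideal P -> (forall Q, prime_ideal Q -> Q `<=` P -> P `<=` Q) -> P r ->
  exists w, ~ P w /\ w * r = 0.
Proof.
move=> red pP Pmin Pr; apply: contrapT => nw.
(* The multiplicative set generated by [r] and the complement of [P]. If it omitted 0, a prime
   avoiding it would lie in [P] without containing [r], against minimality. *)
pose M := [set x | exists w n, ~ P w /\ x = w * r ^+ n].
have i0 : ideal [set 0 : R].
  by split=> // [x y -> ->|s x ->]; rewrite /= ?addr0 ?mulr0.
have [|||Q [pQ _ QM]] := @exists_prime [set 0] M i0.
- by exists 1, 0%N; rewrite mulr1; split=> //; apply: prime1.
- move=> _ _ [w [n [Pw ->]]] [v [m [Pv ->]]]; exists (w * v), (n + m)%N.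
  by split; [move=> /(primeM pP)[]|rewrite exprD; ring].
- move=> _ -> [w [n [Pw /esym wr0]]]; apply: nw; exists w; split=> //.
  apply: (red _ n.+1).
  have -> : (w * r) ^+ n.+1 = w * r ^+ n * (w ^+ n * r).
    by rewrite exprMn !exprS; ring.
  by rewrite wr0 mul0r.
have QP : Q `<=` P.
  move=> x Qx; apply: contrapT => Px; apply: (QM x Qx).
  by exists x, 0%N; rewrite mulr1.
apply: (QM r (Pmin _ pQ QP _ Pr)); exists 1, 1%N; rewrite mul1r expr1.
by split=> //; apply: prime1.
Qed.

End PrimeIdeals.

(** * Extending characters from a ring to polynomials over it *)

Section ExtendCharacter.
Import Pdiv.Ring Pdiv.ComRing.
Variables (k : closedFieldType) (B : comNzRingType) (P : set {poly B}).
Hypothesis pP : prime_ideal P.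

(** [Q] is the contraction of [P] to [B]; [vanishes] is membership in the extension of [Q] to the
    polynomial ring. *)
Let Q : set B := [set b | P b%:P].
Let vanishes (p : {poly B}) := forall i, Q p`_i.

Let polyE (p : {poly B}) : p = \sum_(i < size p) (p`_i)%:P * 'X^i.
Proof. by rewrite -[LHS]coefK poly_def; apply: eq_bigr => i _; rewrite mul_polyC. Qed.

Let vanishes_in p : vanishes p -> P p.
Proof.
move=> vp; rewrite (polyE p); apply: ideal_sum (prime_is_ideal pP) _ => i.
by rewrite mulrC; apply: idealM (prime_is_ideal pP) _ _ _; apply: vp.
Qed.

Let vanishesB p q : vanishes p -> vanishes q -> vanishes (p - q).
Proof.
move=> vp vq i; have := idealB (prime_is_ideal pP) (vp i) (vq i).
by rewrite -polyCB -coefB.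
Qed.

Let vanishesM p q : vanishes p -> vanishes (p * q).
Proof.
move=> vp i; rewrite coefM /Q /= raddf_sum.
apply: ideal_sum (prime_is_ideal pP) _ => j /=; rewrite rmorphM mulrC.
exact: idealM (prime_is_ideal pP) _ _ (vp _).
Qed.

Let vanishesBK p q : vanishes (p - q) -> P p -> P q.
Proof.
move=> /vanishes_in Ppq Pp; rewrite -(subKr p q).
exact: idealB (prime_is_ideal pP) Pp Ppq.
Qed.

(* Truncating the leading terms that lie in [Q]. *)
Let lead_reduce p : ~ vanishes p ->
  exists p', [/\ ~ Q (lead_coef p'), (size p' <= size p)%N & vanishes (p - p')].
Proof.
have [n] := ubnP (size p); elim: n p => // n IHn p; rewrite ltnS => pn nvp.
have [Qp|] := pselect (Q (lead_coef p)); last first.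
  move=> nQ; exists p; split=> //; rewrite subrr => i; rewrite coef0.
  exact: ideal0 (prime_is_ideal pP).
have p0 : (0 < size p)%N.
  rewrite size_poly_gt0; apply: contra_notN nvp => /eqP-> i; rewrite coef0.
  exact: ideal0 (prime_is_ideal pP).
pose t := take_poly (size p).-1 p.
have st : (size t < size p)%N by rewrite -(prednK p0) ltnS size_take_poly.
have vt : vanishes (p - t).
  move=> i; rewrite coefB coef_take_poly /Q /=.
  have [ip|] := ltnP; first by rewrite subrr; apply: ideal0 (prime_is_ideal pP).
  rewrite leq_eqVlt subr0 => /predU1P[<- //|]; rewrite prednK // => pi.
  by rewrite nth_default //; apply: ideal0 (prime_is_ideal pP).
have [||p' [nQ sp' vp']] := IHn t.
- exact: leq_trans st pn.
- move=> vt'; apply: nvp; have -> : p = (p - t) - (t - t - t) by ring.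
  by apply: (vanishesB vt); apply: vanishesB => //; apply: vanishesB.
exists p'; split=> //; first exact: leq_trans sp' (ltnW st).
have -> : p - p' = (p - t) - (p' - t) by ring.
apply: vanishesB => // i; rewrite -opprB coefN /Q /= polyCN -mulN1r.
exact: idealM (prime_is_ideal pP) _ _ (vp' _).
Qed.

(** If [P] is the extension of [Q], [b] is a coefficient of [f] and any [xi] that is not a root of
    the image of [f] will do. Otherwise [xi] is a root of the image of an element [h] of [P] of
    least degree modulo [Q], and [b] comes from eliminating the variable between [f] and [h]. This
    is the induction step of the Nullstellensatz. *)
Lemma extend_character f : ~ P f -> exists b : B, ~ P b%:P /\
  forall chi : {rmorphism B -> k}, (forall c, P c%:P -> chi c = 0) ->
  chi b != 0 ->
  exists xi, (forall g, P g -> (map_poly chi g).[xi] = 0) /\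
             (map_poly chi f).[xi] != 0.
Proof.
have iP := prime_is_ideal pP.
move=> nPf; have [PQ|] := pselect (forall g, P g -> vanishes g).
  have /existsNP[i nQi] : ~ vanishes f by move=> /vanishes_in.
  exists f`_i; split=> // chi chiQ chif.
  have /closed_nonrootP[xi xi_f] : map_poly chi f != 0.
    by apply: contraNneq chif => f0; rewrite -coef_map f0 coef0.
  exists xi; split=> // g /PQ vg.
  suff -> : map_poly chi g = 0 by rewrite horner0.
  by apply/polyP => j; rewrite coef_map coef0; apply: chiQ (vg j).
move=> /existsNP[h0 /not_implyP[Ph0 nvh0]].
have [h [Ph Qh hmin]] : exists h, [/\ P h, ~ Q (lead_coef h) &
    forall r, P r -> (size r < size h)%N -> vanishes r].
  have ex : exists n,
      `[< exists h : {poly B}, [/\ size h = n, P h & ~ vanishes h] >].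
    by exists (size h0); apply/asboolP; exists h0.
  case: (ex_minnP ex) => n /asboolP[h [sh Ph nvh]] nmin.
  have [h' [Qh' sh' vh']] := lead_reduce nvh.
  exists h'; split=> //; first exact: vanishesBK vh' Ph.
  move=> r Pr sr; apply: contrapT => nvr.
  have /nmin :
      `[< exists h : {poly B}, [/\ size h = size r, P h & ~ vanishes h] >].
    by apply/asboolP; exists r.
  by rewrite leqNgt (leq_trans sr) // -sh.
have sh : (1 < size h)%N.
  rewrite ltnNge; apply/negP => sh; apply: Qh; move: Ph.
  by rewrite [h]size1_polyC // lead_coefC.
have chi_vanishes (chi : {rmorphism B -> k}) g :
    (forall c, P c%:P -> chi c = 0) -> vanishes g -> map_poly chi g = 0.
  by move=> chiQ vg; apply/polyP => j; rewrite coef_map coef0; apply: chiQ (vg j).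
(* Euclid's algorithm by pseudo-division: a common root of the images of [g] and [h] is a root of
   the image of the remainder of [h], and the descent ends at a constant outside [Q]. *)
have main g : ~ P g -> (size g <= size h)%N -> exists b, ~ Q b /\
    forall (chi : {rmorphism B -> k}) xi, (forall c, P c%:P -> chi c = 0) ->
    chi b != 0 -> root (map_poly chi h) xi -> (map_poly chi g).[xi] != 0.
  have [n] := ubnP (size g); elim: n g => // n IHn g; rewrite ltnS => gn nPg gh.
  have [|g' [Qg' sg' vg']] := @lead_reduce g; first by move=> /vanishes_in.
  have nPg' : ~ P g'.
    move=> Pg'; apply: nPg; rewrite -(subrK g' g).
    by apply: (idealD iP) => //; apply: vanishes_in.
  have chig (chi : {rmorphism B -> k}) : (forall c, P c%:P -> chi c = 0) ->
      map_poly chi g = map_poly chi g'.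
    by move=> chiQ; apply/subr0_eq; rewrite -rmorphB /= chi_vanishes.
  have [s1|s2] := leqP (size g') 1.
    exists g'`_0; split; first by rewrite /Q /= -size1_polyC.
    move=> chi xi chiQ chib _.
    by rewrite chig // [g']size1_polyC // map_polyC hornerC.
  pose q := rdivp h g'; pose r := rmodp h g'.
  have g'0 : g' != 0 by rewrite -size_poly_gt0; apply: leq_trans s2.
  have sr : (size r < size g')%N by rewrite ltn_rmodp.
  have E := rdivp_eq g' h; rewrite -/q -/r in E.
  (* If [r] lay in [P], so would [q]; both would vanish modulo [Q], and then so would the product of
     [h] by a power of the leading coefficient of [g'], although neither leading coefficient lies in
     [Q]. *)
  have nPr : ~ P r.
    move=> Pr.
    have vr : vanishes r.
      by apply: hmin => //; apply: leq_trans sr (leq_trans sg' gh).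
    have Pq : P q.
      have : P (q * g').
        rewrite -(addrK r (q * g')) -E -mul_polyC.
        by apply: idealB => //; apply: idealM.
      by move=> /(primeM pP)[].
    have vq : vanishes q.
      apply: contrapT => /lead_reduce[q' [Qq' sq' vq']].
      have Pq' := vanishesBK vq' Pq.
      have hq' : (size h <= size q')%N.
        rewrite leqNgt; apply/negP => /(hmin _ Pq')/(_ (size q').-1).
        exact: Qq'.
      have := vanishesM g' vq'; move/(_ (size q' + size g').-2).
      rewrite mulrBl coefB -mul_lead_coef.
      have -> : q * g' = lead_coef g' ^+ rscalp h g' *: h - r by rewrite E addrK.
      have N1 : (size h <= (size q' + size g').-2)%N.
          move: hq' s2; case: (size g') => [|[|m]] //.
          by rewrite !addnS /= => /leq_trans -> //; rewrite leq_addr.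
      rewrite coefB coefZ !nth_default ?mulr0 ?subr0 ?sub0r //; last first.
        by apply: leq_trans N1; apply: ltnW (leq_trans sr (leq_trans sg' gh)).
      rewrite /Q /= polyCN -mulN1r => /(idealM iP (- 1)).
      rewrite mulN1r mulN1r opprK polyCM => /(primeM pP)[].
        exact: Qq'.
      exact: Qg'.
    have : Q (q * g' + r)`_(size h).-1.
      by rewrite coefD /Q /= polyCD; apply: idealD => //; [apply: vanishesM|apply: vr].
    rewrite -E coefZ /Q /= polyCM polyC_exp => /(primeM pP)[/(primeX pP)|].
      exact: Qg'.
    exact: Qh.
  have [||b [Qb main]] := IHn r _ nPr.
  - exact: leq_trans sr (leq_trans sg' gn).
  - exact: ltnW (leq_trans sr (leq_trans sg' gh)).
  exists b; split=> // chi xi chiQ chib xih; rewrite chig //.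
  have := main chi xi chiQ chib xih; apply: contraNneq => g'xi.
  have := congr1 (horner^~ xi \o map_poly chi) E.
  rewrite /= linearZ rmorphD rmorphM /= hornerD hornerM hornerZ g'xi.
  by rewrite (rootP xih) !mulr0 add0r => <-.
pose r := rmodp f h.
have E := rdivp_eq h f; rewrite -/r in E.
have hn0 : h != 0 by rewrite -size_poly_gt0; apply: leq_trans sh.
have nPr : ~ P r.
  move=> Pr; have : P ((lead_coef h ^+ rscalp f h)%:P * f).
    by rewrite mul_polyC E; apply: idealD => //; apply: idealM.
  by move=> /(primeM pP)[|//]; rewrite polyC_exp => /(primeX pP).
have [|b [Qb main_r]] := main r nPr; first by rewrite ltnW // ltn_rmodp.
(* The factor [lead_coef h] preserves the degree of [h] under [chi], so that its image has a root,
   and can be cancelled in the pseudo-division relation. *)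
exists (b * lead_coef h); split.
  by rewrite polyCM => /(primeM pP)[|]; [apply: Qb|apply: Qh].
move=> chi chiQ; rewrite rmorphM mulf_eq0 negb_or => /andP[chib chih].
have /closed_rootP[xi xih] : size (map_poly chi h) != 1.
  by rewrite size_map_poly_id0 // neq_ltn sh orbT.
have rxi := main_r chi xi chiQ chib xih.
have chiE g : (chi (lead_coef h)) ^+ rscalp g h * (map_poly chi g).[xi] =
    (map_poly chi (rmodp g h)).[xi].
  have := congr1 (horner^~ xi \o map_poly chi) (rdivp_eq h g).
  rewrite /= linearZ rmorphD rmorphM /= hornerD hornerM hornerZ.
  by rewrite (rootP xih) mulr0 add0r rmorphXn.
exists xi; split; last by apply: contraNneq rxi => fxi; rewrite -chiE fxi mulr0.
(* The pseudo-remainder of [g] by [h] lies in [P] and is shorter than [h], so it vanishes modulo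
   [Q]. *)
move=> g Pg; apply/eqP; rewrite -(mulrI_eq0 _ (mulfI (expf_neq0 (rscalp g h) chih))).
rewrite chiE chi_vanishes ?horner0 //; apply: hmin; last by rewrite ltn_rmodp.
have -> : rmodp g h = (lead_coef h ^+ rscalp g h)%:P * g - rdivp g h * h.
  by rewrite mul_polyC rdivp_eq addrC addKr.
by apply: idealB => //; apply: idealM.
Qed.

End ExtendCharacter.

Section PolynomialTower.
Variable k : closedFieldType.

(** The polynomial ring in [n] variables, iterated so that [extend_character] handles one variable
    at a time. *)
Fixpoint poly_tower (n : nat) : comNzRingType :=
  if n is m.+1 then {poly (poly_tower m)} else k.

Fixpoint tower_const (n : nat) : {rmorphism k -> poly_tower n} :=
  if n is m.+1 then (polyC \o tower_const m : {rmorphism k -> {poly poly_tower m}})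
  else (idfun : {rmorphism k -> k}).

Lemma tower_character n (P : set (poly_tower n)) f : prime_ideal P -> ~ P f ->
  exists chi : {rmorphism poly_tower n -> k},
    [/\ forall c, chi (tower_const n c) = c, forall p, P p -> chi p = 0 &
        chi f != 0].
Proof.
elim: n P f => [|n IHn] P f pP nPf.
  have P0 (x : k) : P x -> x = 0.
    move=> Px; apply: contra_notP (prime1 pP) => /eqP x0.
    by rewrite -(mulVf x0); apply: idealM (prime_is_ideal pP) _ _ Px.
  exists (idfun : {rmorphism k -> k}); split=> //=.
  by apply: contra_notN nPf => /eqP->; apply: ideal0 (prime_is_ideal pP).
have [b [Qb ext]] := @extend_character k _ _ pP _ nPf.
have iP := prime_is_ideal pP.
have pQ : prime_ideal [set c : poly_tower n | P c%:P].
  split=> [||x y /=]; last by rewrite polyCM; apply: primeM.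
    2: by rewrite /= polyC1; apply: prime1.
  split=> [|x y /= Px Py|r x /= Px]; first by rewrite /= polyC0; apply: ideal0.
    by rewrite polyCD; apply: idealD.
  by rewrite polyCM; apply: idealM.
have [chi [chic chiQ chib]] := IHn _ _ pQ Qb.
have [xi [xiP xif]] := ext chi chiQ chib.
exists (horner_eval xi \o map_poly chi : {rmorphism {poly poly_tower n} -> k}).
by split=> // c /=; rewrite /horner_eval map_polyC hornerC; apply: chic.
Qed.

Fixpoint tower_eval (x : nat -> k) (n : nat) : {rmorphism poly_tower n -> k} :=
  if n is m.+1 then
    (horner_eval (x m) \o map_poly (tower_eval x m)
       : {rmorphism {poly poly_tower m} -> k})
  else (idfun : {rmorphism k -> k}).

Lemma tower_eval_const x n c : tower_eval x n (tower_const n c) = c.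
Proof.
by elim: n => //= n IHn; rewrite /horner_eval map_polyC hornerC; apply: IHn.
Qed.

Lemma tower_eval_var n i : (i < n)%N ->
  exists p, forall x, tower_eval x n p = x i.
Proof.
elim: n => // n IHn; rewrite ltnS leq_eqVlt => /predU1P[->|/IHn[p px]].
  by exists 'X => x /=; rewrite /horner_eval map_polyX hornerX.
by exists p%:P => x /=; rewrite /horner_eval map_polyC hornerC; apply: px.
Qed.

End PolynomialTower.

Section Nullstellensatz.
Variables (k : closedFieldType) (Y : affineVarietyType k).
Implicit Type f g : coordRing Y.

Lemma coordRing_eq f g : (forall y, f y = g y) -> f = g.
Proof. by move=> fg; apply: val_inj; apply/funext. Qed.

Lemma coordD f g y : (f + g) y = f y + g y. Proof. by []. Qed.
Lemma coordB f g y : (f - g) y = f y - g y. Proof. by []. Qed.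
Lemma coordM f g y : (f * g) y = f y * g y. Proof. by []. Qed.
Lemma coord0 y : (0 : coordRing Y) y = 0. Proof. by []. Qed.
Lemma coord1 y : (1 : coordRing Y) y = 1. Proof. by []. Qed.
Lemma coordC c y : coord_const Y c y = c. Proof. by []. Qed.
Lemma coordX f n y : (f ^+ n) y = f y ^+ n.
Proof. by elim: n => // n IHn; rewrite !exprS coordM IHn. Qed.
Lemma coord_sum (J : Type) (s : seq J) (F : J -> coordRing Y) y :
  (\sum_(j <- s) F j) y = \sum_(j <- s) F j y.
Proof. by elim/big_ind2: _ => // f a g b <- <-. Qed.

Lemma coord_reduced f n : f ^+ n = 0 -> f = 0.
Proof.
move=> fn0; apply: coordRing_eq => y.
have := congr1 (fun h : coordRing Y => h y) fn0.
by rewrite coordX coord0 => /eqP; rewrite expf_eq0 => /andP[_ /eqP].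
Qed.

Lemma tower_eval_regular n (s : nat -> coordRing Y) (p : poly_tower k n) :
  exists f, forall y, f y = tower_eval (s^~ y) n p.
Proof.
elim: n p => [|n IHn] p; first by exists (coord_const Y p).
elim/poly_ind: p => [|p c [f fp]]; first by exists 0 => y; rewrite rmorph0.
have [g gc] := IHn c; exists (f * s n + g) => y.
rewrite rmorphD rmorphM coordD coordM fp gc /=.
by rewrite /horner_eval map_polyX hornerX map_polyC hornerC.
Qed.

(** The functions that are polynomials in the generators form a subalgebra containing them, hence
    the whole coordinate ring. *)
Lemma tower_eval_surjective : exists n (s : nat -> coordRing Y),
  forall f, exists p : poly_tower k n, forall y, f y = tower_eval (s^~ y) n p.
Proof.
have [s [sreg sgen]] := @regular_fin_gen k Y.
pose t i : coordRing Y := insubd 0 (nth 0 s i).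
exists (size s), t => f.
pose A : {pred Y -> k} :=
  [pred f | `[< exists p, forall y, f y = tower_eval (t^~ y) (size s) p >]].
have subA : subalgebra A.
  split; last first.
    move=> c; apply/asboolP; exists (tower_const k _ c) => y.
    by rewrite tower_eval_const.
  split=> [|g h /asboolP[p gp] /asboolP[q hq]|g h /asboolP[p gp] /asboolP[q hq]].
  - by apply/asboolP; exists 1 => y; rewrite rmorph1.
  - by apply/asboolP; exists (p - q) => y; rewrite rmorphB -gp -hq.
  - by apply/asboolP; exists (p * q) => y; rewrite rmorphM -gp -hq.
have sA : {subset s <= A}.
  move=> g gs; apply/asboolP.
  have [p pE] := @tower_eval_var k (size s) (index g s)
    (etrans (index_mem g s) gs).
  exists p => y; rewrite pE /t nth_index //.
  by rewrite /insubd insubT //; apply: sreg.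
by have /asboolP := sgen A subA sA _ (coordRingP f).
Qed.

(** A prime above [I] that misses the powers of [f] is pulled back to a polynomial ring mapping onto
    the coordinate ring; a character killing it but not [f] factors through the coordinate ring and
    is therefore a point. *)
Theorem Nullstellensatz (I : set (coordRing Y)) f :
  ideal I -> (forall n, ~ I (f ^+ n)) ->
  exists y, (forall g, I g -> g y = 0) /\ f y != 0.
Proof.
move=> iI nIf.
have [|||P [pP IP PM]] := @exists_prime _ I [set g | exists n, g = f ^+ n] iI.
- by exists 0%N.
- by move=> _ _ [n ->] [m ->]; exists (n + m)%N; rewrite exprD.
- by move=> g Ig [n gE]; apply: (nIf n); rewrite -gE.
have iP := prime_is_ideal pP.
have [n [s sP]] := tower_eval_surjective; have /choice[q qE] := sP.
pose P' := [set p : poly_tower k n |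
  exists g, (forall y, g y = tower_eval (s^~ y) n p) /\ P g].
have pP' : prime_ideal P'.
  split=> [||p p' [g [gE Pg]]].
  - split=> [|p p' [g [gE Pg]] [g' [g'E Pg']]|r p [g [gE Pg]]].
    + by exists 0; split=> [y|]; [rewrite rmorph0|apply: ideal0].
    + by exists (g + g'); split=> [y|]; [rewrite rmorphD -gE -g'E|apply: idealD].
    + have [h hE] := tower_eval_regular s r.
      by exists (h * g); split=> [y|]; [rewrite rmorphM -hE -gE|apply: idealM].
  - move=> [g [gE Pg]]; apply: (prime1 pP).
    by have -> : 1 = g; [apply: coordRing_eq => y; rewrite gE rmorph1|].
  - have [h hE] := tower_eval_regular s p; have [h' h'E] := tower_eval_regular s p'.
    have : P (h * h').
      have -> // : h * h' = g.
      by apply: coordRing_eq => y; rewrite gE rmorphM -hE -h'E.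
    by move=> /(primeM pP)[Ph|Ph]; [left; exists h|right; exists h'].
have nP'f : ~ P' (q f).
  move=> [g [gE Pg]]; apply: (PM _ Pg); exists 1%N; rewrite expr1.
  by apply: coordRing_eq => y; rewrite gE qE.
have [chi [chic chiP chif]] := tower_character pP' nP'f.
have chiE p g : (forall y, g y = tower_eval (s^~ y) n p) -> chi (q g) = chi p.
  move=> gE; apply/subr0_eq; rewrite -rmorphB; apply: chiP; exists 0.
  by split=> [y|]; [rewrite rmorphB -qE -gE subrr|apply: ideal0].
(* [regular_point] takes a map on all functions; [insubd] replaces those that are not regular by
   0. *)
pose ev (g : Y -> k) := chi (q (insubd 0 g)).
have evE g : ev (val g) = chi (q g) by rewrite /ev valKd.
have [|||y yE] := @regular_point k Y ev.
- move=> g h gr hr; rewrite -[g](insubdK (0 : coordRing Y) gr).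
  rewrite -[h](insubdK (0 : coordRing Y) hr).
  set g' := insubd _ g; set h' := insubd _ h.
  rewrite -[val g' + val h']/(val (g' + h')) !evE -rmorphD.
  by apply: chiE => y; rewrite coordD rmorphD -!qE.
- move=> g h gr hr; rewrite -[g](insubdK (0 : coordRing Y) gr).
  rewrite -[h](insubdK (0 : coordRing Y) hr).
  set g' := insubd _ g; set h' := insubd _ h.
  rewrite -[val g' * val h']/(val (g' * h')) !evE -rmorphM.
  by apply: chiE => y; rewrite coordM rmorphM -!qE.
- move=> c; rewrite -[cst c]/(val (coord_const Y c)) evE -[RHS](chic c).
  by apply: chiE => y; rewrite tower_eval_const.
exists y; split=> [g Ig|].
  rewrite -(yE _ (coordRingP g)) evE; apply: chiP; exists g.
  by split=> [z|]; [apply: qE|apply: IP].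
by rewrite -(yE _ (coordRingP f)) evE.
Qed.

Corollary weak_Nullstellensatz (I : set (coordRing Y)) :
  ideal I -> ~ I 1 -> exists y, forall g, I g -> g y = 0.
Proof.
move=> iI nI1; have [|y [yI _]] := @Nullstellensatz I 1 iI; last by exists y.
by move=> n; rewrite expr1n.
Qed.

End Nullstellensatz.

(** * Rational modules and fixed points *)

(** The vectors of [s] are traded for values of [F] at points of [P]: if the first coefficient [m]
    is nonzero at some [y0] in [P], subtracting [m y / m y0] times [F y0] removes its term and
    shortens the sum. *)
Lemma finite_coefficients (k : closedFieldType) (Y : affineVarietyType k)
    (V : lmodType k) (P : set Y) (s : seq (coordRing Y * V)) (F : Y -> V) :
  (forall y, P y -> F y = \sum_(q <- s) q.1 y *: q.2) ->
  exists n (z : 'I_n -> Y) (r : 'I_n -> coordRing Y),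
    (forall i, P (z i)) /\
    forall y, P y -> F y = \sum_i r i y *: F (z i).
Proof.
have [n] := ubnP (size s); elim: n s F => // n IHn [|[m e] s] F.
  move=> _ F0; have z : 'I_0 -> Y by case.
  exists 0%N, z, (fun=> 0).
  by split=> [[]|y /F0] //; rewrite big_nil big_ord0.
rewrite ltnS => sn FE.
have [m0|/existsNP[y0 /not_implyP[Py0 /eqP my0]]] :=
  pselect (forall y, P y -> m y = 0).
  by apply: (IHn s) => // y Py; rewrite FE // big_cons m0 // scale0r add0r.
pose s' := [seq (q.1 - coord_const Y (q.1 y0 / m y0) * m, q.2)
             | q : coordRing Y * V <- s].
pose F' y := F y - (m y / m y0) *: F y0.
have [||j [z [r [Pz F'E]]]] := IHn s' F'; first by rewrite size_map.
  move=> y Py; rewrite /F' !FE // !big_cons big_map /= scalerDr scalerA.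
  rewrite divfK // opprD addrACA subrr add0r scaler_sumr -sumrB.
  apply: eq_bigr => q _; rewrite -[X in _ = X *: _]/(q.1 y - q.1 y0 / m y0 * m y).
  rewrite scalerBl scalerA.
  by congr (_ - _ *: _); rewrite mulrAC -mulrA mulrC.
(* The coefficient of [F y0] is [m y / m y0] together with the corrections from rewriting each
   [F' (z l)] in terms of [F]. *)
exists j.+1, (fun i => if unlift ord0 i is Some l then z l else y0),
  (fun i => if unlift ord0 i is Some l then r l
     else coord_const Y (m y0)^-1 * (m - \sum_l r l * coord_const Y (m (z l)))).
split=> [i|y Py]; first by case: unliftP.
rewrite big_ord_recl unlift_none.
rewrite [X in _ + X](eq_bigr (fun l => r l y *: F (z l))); last first.
  by move=> l _; rewrite liftK.
have := F'E y Py; rewrite {1}/F' => /eqP; rewrite subr_eq => /eqP ->.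
rewrite (eq_bigr (fun l => r l y *: F (z l) -
  (r l y * (m (z l) / m y0)) *: F y0)); last first.
  by move=> l _; rewrite scalerBr scalerA.
rewrite sumrB -scaler_suml -addrA addrC -scaleNr -scalerDl; congr (_ *: _ + _).
rewrite coordM coordC coordB coord_sum mulrBr addrC mulrC; congr (_ - _).
by rewrite mulr_sumr; apply: eq_bigr => l _; rewrite coordM coordC; ring.
Qed.

Section RationalModules.
Variables (k : closedFieldType) (G : affineGroupType k) (V : lmodType k).
Variable ga : G -> V -> V.

(** As long as the spanning vectors are dependent, one of them is eliminated and its row of
    coefficients is distributed over the others. *)
Lemma independent_matrix_coefficients n (e : 'I_n -> V)
    (m : 'I_n -> 'I_n -> coordRing G) v :
  (exists c : 'I_n -> k, v = \sum_i c i *: e i) ->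
  (forall g j, ga g (e j) = \sum_i m i j g *: e i) ->
  exists n (e : 'I_n -> V) (m : 'I_n -> 'I_n -> coordRing G),
    [/\ forall c : 'I_n -> k, \sum_i c i *: e i = 0 -> forall i, c i = 0,
        exists c : 'I_n -> k, v = \sum_i c i *: e i &
        forall g j, ga g (e j) = \sum_i m i j g *: e i].
Proof.
elim: n e m => [|n IHn] e m [c vE] eE.
  by exists 0%N, e, m; split=> // [? _ []//|]; exists c.
have [ind|/existsNP[d /not_implyP[d0 /existsNP[l /eqP dl]]]] :=
  pselect (forall c : 'I_n.+1 -> k, \sum_i c i *: e i = 0 -> forall i, c i = 0).
  by exists n.+1, e, m; split=> //; exists c.
pose b j := - (d l)^-1 * d (lift l j).
have el : e l = \sum_j b j *: e (lift l j).
  move: d0; rewrite (bigD1_ord l) //= => /eqP; rewrite addr_eq0 => /eqP.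
  move=> /(congr1 (fun u => (d l)^-1 *: u)); rewrite scalerA mulVf // scale1r => ->.
  rewrite scalerN scaler_sumr -sumrN; apply: eq_bigr => j _.
  by rewrite scalerA /b mulNr scaleNr.
have split_l (f : 'I_n.+1 -> k) :
    \sum_i f i *: e i = \sum_j (f (lift l j) + f l * b j) *: e (lift l j).
  rewrite (bigD1_ord l) //= el scaler_sumr -big_split; apply: eq_bigr => j _ /=.
  by rewrite scalerA -scalerDl addrC.
apply: (IHn (fun j => e (lift l j))
  (fun i j => m (lift l i) (lift l j) + m l (lift l j) * coord_const G (b i))).
  by exists (fun j => c (lift l j) + c l * b j); rewrite vE split_l.
by move=> g j; rewrite eE split_l.
Qed.

(** By [finite_coefficients] the orbit of [v] is spanned by finitely many translates of [v], with
    regular coefficients [r i]; the action on these translates has translates of the [r i] as matrix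
    entries. *)
Lemma rational_of_coefficients :
  (forall g, linear (ga g)) -> (forall v, ga 1%g v = v) ->
  (forall g h v, ga (g * h)%g v = ga g (ga h v)) ->
  (forall v, exists s : seq (coordRing G * V),
     forall g, ga g v = \sum_(q <- s) q.1 g *: q.2) ->
  rational_module ga.
Proof.
move=> lin ga1 gaM coef; split=> // v; have [s sE] := coef v.
have [|n [z [r [_ rE]]]] := @finite_coefficients k G V setT s (ga^~ v).
  by move=> g _; apply: sE.
pose m i j := comorphism (translation_regular (right_mul_action G) (z j)) (r i).
apply: (@independent_matrix_coefficients n (fun i => ga (z i) v) m).
  by exists (fun i => r i 1%g); rewrite -(rE 1%g) // ga1.
by move=> g j; rewrite -gaM rE.
Qed.

End RationalModules.

(** * Fixed points in subquotients of modules of functions *)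

Section FixedPoints.
Variables (k : closedFieldType) (G : affineGroupType k).
Variables (X : affineVarietyType k) (a : regular_action G X).
Variables (T : Type) (p : T -> X) (act : T -> G -> T).
Hypothesis act1 : forall t, act t 1%g = t.
Hypothesis actM : forall t g h, act t (g * h)%g = act (act t g) h.
Hypothesis p_act : forall t g, p (act t g) = a (p t) g.

Definition translate (g : G) (u : T -> k) (t : T) := u (act t g).

(** The conditions for a (G, k[X])-submodule of the functions on a set [T] lying over [X]; [T] will
    be [G], and later the product of [G] with itself. *)
Record equivariant_submodule (S : set (T -> k)) : Prop := {
  esub0 : S 0;
  esubD : forall u v, S u -> S v -> S (u + v);
  esubM : forall (f : coordRing X) u, S u -> S ((f \o p) * u);
  esub_translate : forall g u, S u -> S (translate g u)
}.

Lemma esubN S u : equivariant_submodule S -> S u -> S (- u).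
Proof.
move=> eS Su; have -> : - u = (coord_const X (- 1) \o p) * u.
  by apply/funext => t; rewrite /GRing.mul /= mulN1r.
exact: esubM.
Qed.

Lemma esubB S u v : equivariant_submodule S -> S u -> S v -> S (u - v).
Proof. by move=> eS Su Sv; apply: esubD => //; apply: esubN. Qed.

Variables S N : set (T -> k).
Hypotheses (eS : equivariant_submodule S) (eN : equivariant_submodule N).
Hypothesis S_coef : forall u, S u -> exists s : seq (coordRing G * (T -> k)),
  forall g t, u (act t g) = \sum_(q <- s) q.1 g * q.2 t.

Let inS : {pred T -> k} := [pred u | `[< S u >]].

Let inS_zmod_closed : zmod_closed inS.
Proof.
split; first by apply/asboolP; apply: esub0.
by move=> u v /asboolP Su /asboolP Sv; apply/asboolP; apply: esubB.
Qed.

Record sub_functions := SubFunction {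
  sub_function : T -> k;
  sub_functionP : sub_function \in inS
}.

HB.instance Definition _ := [isSub for sub_function].
HB.instance Definition _ := [Choice of sub_functions by <:].
HB.instance Definition _ := GRing.SubChoice_isSubZmodule.Build
  (T -> k) inS sub_functions inS_zmod_closed.

Let subS (u : sub_functions) : S (val u) := elimT (asboolP _) (valP u).
Let mkS u (Su : S u) : sub_functions := SubFunction (introT (asboolP _) Su).

Definition inN (u : sub_functions) : bool := `[< N (val u) >].

Let inN_zmod_closed : zmod_closed inN.
Proof.
split; first by apply/asboolP; apply: esub0.
by move=> u v /asboolP Su /asboolP Sv; apply/asboolP; rewrite raddfB; apply: esubB.
Qed.

Definition N_closed : zmodClosed sub_functions :=
  HB.pack inN (GRing.isZmodClosed.Build sub_functions inN inN_zmod_closed).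

Local Open Scope quotient_scope.

(** This is [S] modulo its intersection with [N]. *)
Definition quotient_functions := Quotient.quot N_closed.
HB.instance Definition _ := GRing.Zmodule.on quotient_functions.
Let Q := quotient_functions.
Let cls (u : sub_functions) : Q := \pi_(Quotient.quot N_closed) u.

Let clsP u v : cls u = cls v <-> N (val u - val v).
Proof.
rewrite -raddfB; split; first by move/eqP; rewrite -Quotient.idealrBE => /asboolP.
by move=> Nuv; apply/eqP; rewrite -Quotient.idealrBE; apply/asboolP.
Qed.

Let clsK (x : Q) : cls (repr x) = x. Proof. exact: reprK. Qed.
Let clsD u v : cls (u + v) = cls u + cls v.
Proof. by rewrite /cls !piE. Qed.
Let cls0 : cls 0 = 0. Proof. by rewrite /cls !piE. Qed.

Let sscale (f : coordRing X) u := mkS (esubM eS f (subS u)).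
Let strans g u := mkS (esub_translate eS g (subS u)).

Definition quotient_scale (f : coordRing X) (x : quotient_functions) :
  quotient_functions := cls (sscale f (repr x)).

Let scale_cls f u : quotient_scale f (cls u) = cls (sscale f u).
Proof.
apply/clsP; rewrite /= -mulrBr; apply: (esubM eN).
by apply/clsP; rewrite clsK.
Qed.

Let scaleA f g x : quotient_scale f (quotient_scale g x) = quotient_scale (f * g) x.
Proof.
rewrite -(clsK x) !scale_cls; congr (cls _); apply: val_inj => /=.
by apply/funext => t; rewrite /GRing.mul /= mulrA.
Qed.

Let scale1 : left_id 1 quotient_scale.
Proof.
move=> x; rewrite -(clsK x) scale_cls; congr (cls _); apply: val_inj => /=.
by apply/funext => t; rewrite /GRing.mul /= mul1r.
Qed.

Let scaleDr : right_distributive quotient_scale +%R.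
Proof.
move=> f x y; rewrite -(clsK x) -(clsK y) -clsD !scale_cls -clsD.
congr (cls _); apply: val_inj => /=.
by apply/funext => t; rewrite /GRing.mul /= mulrDr.
Qed.

Let scaleDl x : {morph quotient_scale^~ x : f g / f + g}.
Proof.
move=> f g; rewrite -(clsK x) !scale_cls -clsD.
congr (cls _); apply: val_inj => /=.
by apply/funext => t; rewrite /GRing.mul /= mulrDl.
Qed.

HB.instance Definition _ := GRing.Zmodule_isLmodule.Build (coordRing X)
  quotient_functions scaleA scale1 scaleDr scaleDl.

Let qact g (x : Q) : Q := cls (strans g (repr x)).

Let qact_cls g u : qact g (cls u) = cls (strans g u).
Proof.
apply/clsP => /=.
have -> : translate g (val (repr (cls u))) - translate g (val u) =
  translate g (val (repr (cls u)) - val u) by [].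
by apply: (esub_translate eN); apply/clsP; rewrite clsK.
Qed.

Let qact_scale g f x : qact g (f *: x) = coord_act a g f *: qact g x.
Proof.
rewrite -(clsK x) [f *: _]scale_cls !qact_cls [RHS]scale_cls.
congr (cls _); apply: val_inj => /=; apply/funext => t.
by rewrite /translate /GRing.mul /= p_act.
Qed.

Let qactD g x y : qact g (x + y) = qact g x + qact g y.
Proof.
rewrite -(clsK x) -(clsK y) -clsD !qact_cls -clsD.
by congr (cls _); apply: val_inj.
Qed.

Let quotient_GR_module : GR_module (coord_const X) (coord_act a) qact.
Proof.
split; last exact: qact_scale.
apply: rational_of_coefficients.
- move=> g c x y; rewrite qactD; congr (_ + _).
  by rewrite /GRing.scale /= qact_scale; congr (_ *: _); apply: coordRing_eq.
- move=> x; rewrite -(clsK x) qact_cls; congr (cls _); apply: val_inj => /=.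
  by apply/funext => t; rewrite /translate act1.
- move=> g h x; rewrite -(clsK x) !qact_cls; congr (cls _); apply: val_inj => /=.
  by apply/funext => t; rewrite /translate actM.
- move=> x; have [s sE] := S_coef (subS (repr x)).
  (* The functions [q.2] may lie outside [S]; replacing them by translates, which lie in [S], lets
     the expansion descend to the quotient. *)
  have [|n [z [r [_ rE]]]] := @finite_coefficients k G (T -> k^o) setT s
    (fun g => translate g (val (repr x))).
    by move=> g _; apply/funext => t; rewrite fct_sumE; apply: sE.
  exists [seq (r i, qact (z i) x) | i <- enum 'I_n] => g.
  rewrite big_map big_enum /=.
  rewrite (eq_bigr (fun i =>
    cls (sscale (coord_const X (r i g)) (strans (z i) (repr x))))); last first.
    by move=> i _; rewrite -scale_cls.
  rewrite -(big_morph cls clsD cls0); congr (cls _); apply: val_inj.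
  by rewrite raddf_sum /= rE //; apply: eq_bigr => i _; apply/funext.
Qed.

Theorem unipotent_fixed_point : unipotent_action a -> (exists u, S u /\ ~ N u) ->
  exists u, [/\ S u, ~ N u & forall g, N (translate g u - u)].
Proof.
move=> unip [u [Su Nu]].
have [|x [x0 xfix]] := unip quotient_functions qact quotient_GR_module.
  exists (cls (mkS Su)); apply: contra_notN Nu.
  by rewrite -cls0 => /eqP/clsP; rewrite subr0.
exists (val (repr x)); split; first exact: subS.
  move=> Nx; case/eqP: x0; rewrite -(clsK x) -cls0.
  by apply/clsP; rewrite subr0.
by move=> g; have := xfix g; rewrite -{2}(clsK x) => /clsP.
Qed.

End FixedPoints.

(** * Freeness of the coordinate ring of the group *)

Section Spans.
Variable R : comPzRingType.

(** [D] will be a subring or an ideal of one; when [E] is everything, the span is the ideal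
    generated by [D]. *)
Definition span_over (D E : set R) : set R := [set f | exists s : seq (R * R),
  (forall q, q \in s -> D q.1 /\ E q.2) /\ f = \sum_(q <- s) q.1 * q.2].

Definition free_over (D E : set R) := forall (s : seq R) (c : R -> R),
  uniq s -> (forall e, e \in s -> E e) -> (forall e, D (c e)) ->
  \sum_(e <- s) c e * e = 0 -> forall e, e \in s -> c e = 0.

Lemma span0 D E : span_over D E 0.
Proof. by exists [::]; rewrite big_nil. Qed.

Lemma spanD D E f g : span_over D E f -> span_over D E g -> span_over D E (f + g).
Proof.
move=> [s [sP ->]] [t [tP ->]]; exists (s ++ t); rewrite big_cat; split=> // q.
by rewrite mem_cat => /orP[/sP|/tP].
Qed.

Lemma span_gen (D E : set R) c e : D c -> E e -> span_over D E (c * e).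
Proof.
move=> Dc Ee; exists [:: (c, e)]; rewrite big_seq1; split=> // q.
by rewrite mem_seq1 => /eqP ->.
Qed.

Lemma span_ind (D E P : set R) : P 0 -> (forall f g, P f -> P g -> P (f + g)) ->
  (forall c e, D c -> E e -> P (c * e)) -> span_over D E `<=` P.
Proof.
move=> P0 PD Pg _ [s [sP ->]]; elim: s sP => [|q s IHs] sP.
  by rewrite big_nil.
rewrite big_cons; apply: PD; first by have [] := sP q (mem_head _ _); apply: Pg.
by apply: IHs => r rs; apply: sP; rewrite inE rs orbT.
Qed.

Lemma span_mul (D D' E : set R) c f : (forall d, D d -> D' (c * d)) ->
  span_over D E f -> span_over D' E (c * f).
Proof.
move=> DD'; move: f; apply: span_ind => [|f g|d e Dd Ee].
- by rewrite mulr0; apply: span0.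
- by rewrite mulrDr; apply: spanD.
- by rewrite mulrA; apply: span_gen => //; apply: DD'.
Qed.

Lemma span_sub (D E E' : set R) : E `<=` E' -> span_over D E `<=` span_over D E'.
Proof.
move=> EE'; apply: span_ind => [|f g|c e Dc Ee]; [exact: span0|exact: spanD|].
by apply: span_gen => //; apply: EE'.
Qed.

Lemma span_uniq (D E : set R) f : D 0 -> (forall c d, D c -> D d -> D (c + d)) ->
  span_over D E f -> exists (s : seq R) (c : R -> R), [/\ uniq s,
    forall e, e \in s -> E e, forall e, D (c e) & f = \sum_(e <- s) c e * e].
Proof.
move=> D0 DD [s [sP ->]].
exists (undup [seq q.2 | q <- s]), (fun e => \sum_(q <- s | q.2 == e) q.1).
split=> [|e|e|]; first exact: undup_uniq.
- by rewrite mem_undup => /mapP[q /sP[_ Eq] ->].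
- by rewrite big_seq_cond; elim/big_ind: _ => // q /andP[/sP[]].
under [RHS]eq_bigr do rewrite mulr_suml.
rewrite (exchange_big_dep xpredT) //= big_seq [RHS]big_seq.
apply: eq_bigr => q qs.
rewrite (eq_bigl (pred1 q.2)) => [|e]; last by rewrite /= eq_sym.
rewrite -big_filter filter_pred1_uniq ?undup_uniq ?big_seq1 //.
by rewrite mem_undup; apply: map_f.
Qed.

Lemma sum_coordinates_sub (s u : seq R) (c : R -> R) : uniq s -> uniq u ->
  {subset s <= u} ->
  \sum_(e <- u) (if e \in s then c e else 0) * e = \sum_(e <- s) c e * e.
Proof.
move=> us uu su; rewrite (bigID (mem s)) /= [X in _ + X]big1 ?addr0; last first.
  by move=> e /negPf->; rewrite mul0r.
rewrite (eq_bigr (fun e => c e * e)) => [|e -> //].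
rewrite -big_filter; apply: perm_big.
apply: uniq_perm => //; first exact: filter_uniq.
by move=> e; rewrite mem_filter andb_idr //; apply: su.
Qed.

(** Coordinates in an independent family are unique, so an expansion with coefficients in [D'] is
    the given one. This serves to show that coordinates lie in an ideal [D'] of [D]. *)
Lemma free_coordinates (D D' E : set R) (s : seq R) (c : R -> R) :
  D 0 -> (forall c d, D c -> D d -> D (c - d)) -> free_over D E ->
  D' 0 -> (forall c d, D' c -> D' d -> D' (c + d)) -> D' `<=` D ->
  uniq s -> (forall e, e \in s -> E e) -> (forall e, D (c e)) ->
  span_over D' E (\sum_(e <- s) c e * e) -> forall e, e \in s -> D' (c e).
Proof.
move=> D0 DB frE D'0 D'D D'sub us sE Dc sp e es.
have [s' [c' [us' s'E D'c' E']]] := span_uniq D'0 D'D sp.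
pose u := undup (s ++ s').
pose d e := (if e \in s then c e else 0) - (if e \in s' then c' e else 0).
have /(_ e) : forall e, e \in u -> d e = 0.
  apply: frE; first exact: undup_uniq.
  - by move=> f; rewrite mem_undup mem_cat => /orP[/sE|/s'E].
  - by move=> f; apply: DB; case: ifP => // _; apply: D'sub.
  - under eq_bigr do rewrite mulrBl.
    rewrite sumrB !sum_coordinates_sub ?undup_uniq ?E' ?subrr // => f fs.
      by rewrite mem_undup mem_cat fs orbT.
    by rewrite mem_undup mem_cat fs.
rewrite mem_undup mem_cat es /d es => /(_ isT) /subr0_eq ->.
by case: ifP.
Qed.

Lemma span_ideal (D : set R) : ideal (span_over D setT).
Proof.
split; [exact: span0|exact: spanD|move=> r].
apply: span_ind => [|f h|c e Dc _].
- by rewrite mulr0; apply: span0.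
- by rewrite mulrDr; apply: spanD.
- by rewrite mulrCA; apply: span_gen.
Qed.

Lemma span_basis (S D E : set R) : (forall c d, D c -> S d -> D (c * d)) ->
  (forall f, span_over S E f) -> span_over D setT `<=` span_over D E.
Proof.
move=> DS Espan; apply: span_ind => [|f h|c e Dc _]; [exact: span0|exact: spanD|].
by apply: span_mul (Espan e) => d; apply: DS.
Qed.

End Spans.

(** * Stable submodules and subalgebras of k[G] along an orbit map *)

Section OrbitMap.
Variables (k : closedFieldType) (G : affineGroupType k).
Variables (X : affineVarietyType k) (a : regular_action G X) (x : X).
Hypothesis unip : unipotent_action a.

Notation A := (coordRing G).
Notation rt := (coord_act (right_mul_action G)).
Definition pullback (b : coordRing X) : A := comorphism (orbit_map_regular a x) b.
Notation pb := pullback.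

Lemma pullbackE b g : pb b g = b (a x g). Proof. by []. Qed.
Lemma pullbackD b c : pb (b + c) = pb b + pb c. Proof. exact: val_inj. Qed.
Lemma pullbackM b c : pb (b * c) = pb b * pb c. Proof. exact: val_inj. Qed.
Lemma pullbackC c : pb (coord_const X c) = coord_const G c. Proof. exact: val_inj. Qed.

Lemma rtE g (f : A) h : rt g f h = f (h * g)%g. Proof. by []. Qed.
Lemma rtD g (f h : A) : rt g (f + h) = rt g f + rt g h. Proof. exact: val_inj. Qed.
Lemma rtM g (f h : A) : rt g (f * h) = rt g f * rt g h. Proof. exact: val_inj. Qed.
Lemma rt_pullback g b : rt g (pb b) = pb (coord_act a g b).
Proof. by apply: coordRing_eq => h; rewrite rtE !pullbackE reg_actM. Qed.

Record stable_submodule (S : set A) : Prop := {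
  ssub0 : S 0;
  ssubD : forall f h, S f -> S h -> S (f + h);
  ssubM : forall b f, S f -> S (pb b * f);
  ssub_rt : forall g f, S f -> S (rt g f)
}.

Record stable_subalgebra (S : set A) : Prop := {
  salg_pb : forall b, S (pb b);
  salgD : forall f h, S f -> S h -> S (f + h);
  salgM : forall f h, S f -> S h -> S (f * h);
  salg_rt : forall g f, S f -> S (rt g f)
}.

Lemma salgC S c : stable_subalgebra S -> S (coord_const G c).
Proof. by move=> sS; rewrite -pullbackC; apply: salg_pb. Qed.

Lemma salg0 S : stable_subalgebra S -> S 0.
Proof. by move=> sS; rewrite -(rmorph0 (coord_const G)); apply: salgC. Qed.

Lemma salg1 S : stable_subalgebra S -> S 1.
Proof. by move=> sS; rewrite -(rmorph1 (coord_const G)); apply: salgC. Qed.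

Lemma salgB S f h : stable_subalgebra S -> S f -> S h -> S (f - h).
Proof.
move=> sS Sf Sh; apply: salgD => //; rewrite -mulN1r; apply: salgM => //.
by rewrite -(rmorph1 (coord_const G)) -rmorphN; apply: salgC.
Qed.

Lemma salg_submodule S : stable_subalgebra S -> stable_submodule S.
Proof.
move=> sS; split; [exact: salg0|exact: salgD| |exact: salg_rt].
by move=> b f Sf; apply: salgM => //; apply: salg_pb.
Qed.

Lemma pullback_stable : stable_subalgebra [set pb b | b in setT].
Proof.
split=> [b|_ _ [b _ <-] [c _ <-]|_ _ [b _ <-] [c _ <-]|g _ [b _ <-]].
- by exists b.
- by exists (b + c) => //; apply: pullbackD.
- by exists (b * c) => //; apply: pullbackM.
- by exists (coord_act a g b); rewrite // rt_pullback.
Qed.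

Lemma stable_fixed_point S N : stable_submodule S -> stable_submodule N ->
  (exists f, S f /\ ~ N f) ->
  exists f, [/\ S f, ~ N f & forall g, N (rt g f - f)].
Proof.
move=> sS sN [f [Sf Nf]].
have im (M : set A) : stable_submodule M ->
    equivariant_submodule (a x) (fun g h : G => (g * h)%g) [set val u | u in M].
  move=> sM; split=> [|_ _ [u Mu <-] [v Mv <-]|b _ [u Mu <-]|g _ [u Mu <-]].
  - by exists 0 => //; apply: ssub0.
  - by exists (u + v) => //; apply: ssubD.
  - by exists (pb b * u) => //; apply: ssubM.
  - by exists (rt g u) => //; apply: ssub_rt.
have [|||_ [[u Su <-] Nu uN]] := unipotent_fixed_point (a := a)
    (@mulg1 G) (@mulgA G) _ (im S sS) (im N sN) _ unip.
- by move=> g h; rewrite reg_actM.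
- move=> _ [u _ <-]; have [s sE] := @mulg_regular k G u.
  exists [seq (q.2, val q.1) | q : A * A <- s] => g h; rewrite big_map.
  by rewrite [LHS]sE; apply: eq_bigr => q _; rewrite mulrC.
- exists (val f); split; first by exists f.
  by move=> [u Nu /val_inj uf]; apply: Nf; rewrite -uf.
exists u; split=> // [Nu'|g]; first by apply: Nu; exists u.
by have [v Nv vE] := uN g; rewrite (_ : rt g u - u = v) //; apply: val_inj.
Qed.

(** A nonzero element of [I] fixed by all right translations is a constant function. *)
Lemma stable_submodule1 I f : stable_submodule I -> I f -> f != 0 -> I 1.
Proof.
move=> sI If f0.
have s0 : stable_submodule [set 0].
  split=> // [u v -> ->|b u ->|g u ->]; rewrite /= ?addr0 ?mulr0 //.
  exact: val_inj.
have [|u [Iu u0 ufix]] := stable_fixed_point sI s0.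
  by exists f; split=> //; apply/eqP.
have uE g : u g = u 1%g.
  by rewrite -[g]mul1g -rtE; have /subr0_eq -> := ufix g.
have u1 : u 1%g != 0.
  apply: contra_notN u0 => /eqP u1; apply: coordRing_eq => g.
  by rewrite uE u1.
have -> : 1 = pb (coord_const X (u 1%g)^-1) * u.
  by apply: coordRing_eq => g; rewrite coordM pullbackC coordC coord1 uE mulVf.
exact: ssubM.
Qed.

Section Basis.
Variable S : set A.
Hypothesis sS : stable_subalgebra S.

Lemma span_stable E : (forall g e, E e -> span_over S E (rt g e)) ->
  stable_submodule (span_over S E).
Proof.
move=> Ert; split; [exact: span0|exact: spanD|move=> b f|move=> g].
  by apply: span_mul => d Sd; apply: salgM => //; apply: salg_pb.
apply: span_ind => [|f h|c e Sc Ee].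
- by rewrite (_ : rt g 0 = 0); [apply: span0|apply: val_inj].
- by rewrite rtD; apply: spanD.
- rewrite rtM; apply: span_mul (Ert g e Ee) => d Sd.
  by apply: salgM => //; apply: salg_rt.
Qed.

(** The [d] in [S] for which [d * v] lies in the span form a stable submodule; if it were nonzero it
    would contain 1, and [v] would lie in the span. So [v] has coefficient zero in every
    relation. *)
Let adjoin_free (E : set A) v : free_over S E ->
  (forall g e, E e -> span_over S E (rt g e)) -> ~ span_over S E v ->
  (forall g, span_over S E (rt g v - v)) -> free_over S (E `|` [set v]).
Proof.
move=> frE Ert nv vfix s c us sE Sc sum0.
have sT := span_stable Ert.
have span_mulS d f : S d -> span_over S E f -> span_over S E (d * f).
  by move=> Sd; apply: span_mul => d' Sd'; apply: salgM.
have ann d : S d -> span_over S E (d * v) -> d = 0.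
  move=> Sd dv; apply/eqP; apply: contraT => d0; exfalso; apply: nv.
  pose I := [set d | S d /\ span_over S E (d * v)].
  suff : I 1 by rewrite /I /= mul1r => -[].
  apply: (stable_submodule1 _ _ d0) => //; split.
  - by split; [apply: salg0|rewrite mul0r; apply: span0].
  - move=> f h [Sf fv] [Sh hv]; split; first exact: salgD.
    by rewrite mulrDl; apply: spanD.
  - move=> b f [Sf fv]; split; first by apply: salgM => //; apply: salg_pb.
    by rewrite -mulrA; apply: (ssubM sT).
  - move=> g f [Sf fv]; split; first exact: salg_rt.
    have -> : rt g f * v =
      rt g (f * v) + rt g (coord_const G (-1) * f) * (rt g v - v).
      rewrite !rtM (_ : rt g (coord_const G (-1)) = - 1); first by ring.
      exact: coordRing_eq.
    apply: spanD; first exact: (ssub_rt sT).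
    apply: span_mulS => //; apply: salg_rt => //; apply: salgM => //.
    exact: salgC.
have [vs|nvs] := boolP (v \in s); last first.
  apply: frE us _ Sc sum0 => e es; have [//|/= ev] := sE e es.
  by rewrite -ev es in nvs.
have sE' e : e \in rem v s -> E e.
  rewrite mem_rem_uniq // !inE => /andP[/eqP ev es].
  by have [] := sE e es.
move: sum0; rewrite (big_rem v vs) /= => sum0.
have cv : c v = 0.
  apply: ann => //; move/eqP: sum0; rewrite addr_eq0 => /eqP ->.
  rewrite -sumrN big_seq; elim/big_ind: _ => [|f h|e /sE' Ee].
  - exact: span0.
  - exact: spanD.
  - rewrite -mulNr; apply: span_gen => //; rewrite -sub0r.
    by apply: salgB => //; apply: salg0.
rewrite cv mul0r add0r in sum0 => e es.
have [-> //|ev] := eqVneq e v.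
by apply: (frE (rem v s)) => //; rewrite ?rem_uniq // mem_rem_uniq // !inE ev.
Qed.

(** Zorn's lemma for independent sets that contain 1 and have a stable span: if the span of a
    maximal one were proper, a fixed point of the quotient could be adjoined by [adjoin_free]. *)
Theorem stable_subalgebra_basis :
  exists E, [/\ E 1, free_over S E & forall f, span_over S E f].
Proof.
pose P E := free_over S E /\ forall g e, E e -> span_over S E (rt g e).
have [||E [[frE Ert] E1 Emax]] := @Zorn_above _ P [set 1].
- split.
  + move=> s c us s1 Sc; case: s us s1 => [//|e [|e' s]] /=.
      move=> _ s1; have -> : e = 1 := s1 e (mem_head _ _).
      by rewrite big_seq1 mulr1 => c1 f; rewrite mem_seq1 => /eqP ->.
    move=> /andP[/negP ee' _] s1; case: ee'.
    have -> : e = 1 := s1 e (mem_head _ _).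
    have -> : e' = 1 by apply: s1; rewrite !inE eqxx orbT.
    exact: mem_head.
  + move=> g _ ->; exists [:: (1, 1)]; rewrite big_seq1 mulr1.
    split=> [q|]; first rewrite mem_seq1 => /eqP ->; last exact: val_inj.
    by split=> //; apply: salg1.
- move=> F [E0 FE0] FP F1 Ftot; split=> [s c us sF Sc sum0|g e [E FE Ee]].
    have [E [FE sE]] : exists E, F E /\ forall e, e \in s -> E e.
      move: sF; clear -FE0 Ftot; elim: s => [|e s IHs] sF; first by exists E0.
      have [|E [FE sE]] := IHs; first by move=> f fs; apply: sF; rewrite inE fs orbT.
      have [E' FE' E'e] := sF e (mem_head _ _).
      case: (Ftot _ _ FE FE') => EE'; [exists E'|exists E]; split=> // f;
        rewrite inE => /predU1P[->//|/sE//]; by [apply: EE'|move=> _; apply: EE'].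
    by apply: (FP _ FE).1 sum0.
  by apply: span_sub ((FP _ FE).2 g e Ee) => f Ef; exists E.
exists E; split=> //; first exact: E1.
move=> f; apply: contrapT => nf.
have sT : stable_submodule setT by [].
have [|v [_ nv vfix]] := stable_fixed_point sT (span_stable Ert).
  by exists f.
apply: (nv); rewrite -(mul1r v); apply: span_gen; first exact: salg1.
apply: (Emax (E `|` [set v])); [|by left|by right].
have sub : span_over S E `<=` span_over S (E `|` [set v]) by apply: span_sub; left.
split; first exact: (adjoin_free frE Ert nv vfix).
move=> g e [Ee|->]; first by apply: sub; apply: Ert.
rewrite -(subrK v (rt g v)); apply: spanD; first by apply: sub; apply: vfix.
by rewrite -{2}(mul1r v); apply: span_gen; [apply: salg1|right].
Qed.

(** The kernel [D] of [chi] on [S] generates a proper ideal of k[G], since 1 belongs to a basis over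
    [S]. A zero of this ideal is the desired point, because [f] minus the constant [chi f] lies in
    [D]. *)
Theorem character_is_point (chi : A -> k) :
  (forall f h, S f -> S h -> chi (f + h) = chi f + chi h) ->
  (forall f h, S f -> S h -> chi (f * h) = chi f * chi h) ->
  (forall c, chi (coord_const G c) = c) ->
  exists g, forall f, S f -> chi f = f g.
Proof.
move=> chiD chiM chiC; have [E [E1 frE Espan]] := stable_subalgebra_basis.
pose D := [set c | S c /\ chi c = 0].
have D0 : D 0 by split; [apply: salg0|rewrite -(rmorph0 (coord_const G)) chiC].
have DD c d : D c -> D d -> D (c + d).
  by move=> [Sc c0] [Sd d0]; split; [apply: salgD|rewrite chiD // c0 d0 addr0].
have DM c d : D c -> S d -> D (c * d).
  by move=> [Sc c0] Sd; split; [apply: salgM|rewrite chiM // c0 mul0r].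
(* By uniqueness of coordinates, 1 in the ideal generated by [D] would mean 1 in [D]. *)
have nD1 : ~ span_over D setT 1.
  move=> /(span_basis DM Espan) D1.
  have [_] : D 1.
    apply: (free_coordinates (D := S) (s := [:: 1]) (c := fun=> 1)
      (salg0 sS) _ frE D0 DD) => //.
    - by move=> c d; apply: salgB.
    - by move=> c [].
    - by move=> e; rewrite mem_seq1 => /eqP ->.
    - by move=> e; apply: salg1.
    - by rewrite big_seq1 mulr1.
    - exact: mem_head.
  by rewrite -(rmorph1 (coord_const G)) chiC => /eqP; rewrite oner_eq0.
have [g gD] := weak_Nullstellensatz (span_ideal _) nD1.
exists g => f Sf; apply/esym/subr0_eq.
rewrite -[LHS]/((f - coord_const G (chi f)) g); apply: gD.
rewrite -[_ - _]mulr1; apply: span_gen => //; split.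
  by apply: salgB => //; apply: salgC.
by rewrite -rmorphN chiD ?chiC ?subrr //; apply: salgC.
Qed.

End Basis.

(** A common zero [y] of the kernel of the pullback defines a character of the image of the
    pullback; this is the evaluation at some [g], and [y] is then the translate of [x] by [g]. *)
Theorem unipotent_orbit_closed : zclosed (action_orbit a x).
Proof.
exists [set b | pb b = 0]; rewrite eqEsubset; split=> y.
  by move=> [g _ <-] b /= b0; rewrite -pullbackE b0.
(* A preimage of [f] is chosen, 0 if there is none; its value at [y] is independent of the choice
   because [y] is a zero of the kernel. *)
move=> /= yP; pose chi (f : A) := xget 0 [set b | pb b = f] y.
have chiE b : chi (pb b) = b y.
  rewrite /chi; case: xgetP => [c _ /= cb|/(_ b)[]//].
  apply/subr0_eq; rewrite -coordB; apply: yP.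
  by rewrite pullbackD (_ : pb (- b) = - pb b) ?cb ?subrr //; apply: val_inj.
have [||c|g gE] := character_is_point pullback_stable (chi := chi).
- by move=> _ _ [b1 _ <-] [b2 _ <-]; rewrite -pullbackD !chiE.
- by move=> _ _ [b1 _ <-] [b2 _ <-]; rewrite -pullbackM !chiE.
- by rewrite -pullbackC chiE.
exists g => //; apply: regular_separates => f fr.
have := gE (pb (CoordRing fr)) ltac:(by exists (CoordRing fr)).
by rewrite chiE => /esym.
Qed.

End OrbitMap.

(** * Isotropy groups *)

Section Isotropy.
Variables (k : closedFieldType) (G : affineGroupType k).
Variables (X : affineVarietyType k) (a : regular_action G X) (x : X).

Notation A := (coordRing G).
Notation rt := (coord_act (right_mul_action G)).

Definition isotropy : set G := [set g | a x g = x].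

Lemma isotropy_closed_subgroup : closed_subgroup isotropy.
Proof.
split=> [|g h /= gx hx|g /= gx|].
- exact: reg_act1.
- by rewrite /isotropy /= reg_actM gx.
- by rewrite /isotropy /= -{1}gx -reg_actM mulgV reg_act1.
exists [set pullback a x b - coord_const G (b x) | b in setT].
rewrite eqEsubset; split=> g /=.
  by move=> gx _ [b _ <-]; rewrite coordB pullbackE gx subrr.
move=> gP; apply: regular_separates => f fr; apply/subr0_eq.
by have := gP _ (ex_intro2 _ _ (CoordRing fr) I erefl).
Qed.

(* The largest submodule of [k[G]] filtered by submodules on whose successive
   quotients [H] acts trivially. *)
Inductive trivially_filtered (H : set G) : A -> Prop :=
| filtered0 : trivially_filtered H 0
| filteredD f h : trivially_filtered H f -> trivially_filtered H h ->
    trivially_filtered H (f + h)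
| filteredM c f : trivially_filtered H f ->
    trivially_filtered H (coord_const G c * f)
| filtered_step f : (forall h, H h -> trivially_filtered H (rt h f - f)) ->
    trivially_filtered H f.

Lemma trivially_filtered_unipotent (H : set G) h f : H h ->
  trivially_filtered H f -> exists n, iter n (fun u => rt h u - u) f = 0.
Proof.
move=> Hh; set D := fun u : A => rt h u - u.
have D0 n : iter n D 0 = 0.
  by elim: n => //= n ->; apply: coordRing_eq => g; rewrite coordB subrr.
have DD n u v : iter n D (u + v) = iter n D u + iter n D v.
  by elim: n => //= n ->; rewrite /D rtD; ring.
have DM n c u : iter n D (coord_const G c * u) = coord_const G c * iter n D u.
  elim: n => //= n ->; apply: coordRing_eq => g.
  by rewrite /D coordB rtE !coordM coordB rtE !coordC; ring.
have Dle n m u : (n <= m)%N -> iter n D u = 0 -> iter m D u = 0.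
  by move=> /subnK <-; rewrite iterD => ->.
elim=> {f} [|f u _ [n fn] _ [m um]|c f _ [n fn]|f _ IH].
- by exists 0%N.
- by exists (maxn n m); rewrite DD (Dle n _ f (leq_maxl n m) fn) add0r;
    apply: Dle um; apply: leq_maxr.
- by exists n; rewrite DM fn mulr0.
- by have [n fn] := IH h Hh; exists n.+1; rewrite iterSr.
Qed.

(* A fixed point of the module of functions [g |-> \sum b (x g) (g v)] with
   values in the quotient of [k[G]] by its trivially filtered part (the induced
   module) takes a constant value there, which is fixed by the isotropy group. *)
Lemma isotropy_trivially_filtered f : unipotent_action a ->
  trivially_filtered isotropy f.
Proof.
move=> unip; apply: contrapT => nf.
set fil := trivially_filtered isotropy in nf.
(* In a pair, the first entry is the argument of a function from [G] to k[G], the second the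
   variable of its value. [S] is spanned over k[X] by the functions sending [g] to [rt g v], and [N]
   consists of the functions with values in [fil]. *)
pose act (t : G * G) g := (t.1 * g, t.2)%g.
pose p (t : G * G) := a x t.1.
pose S := [set phi : G * G -> k | exists s : seq (coordRing X * A),
  forall t, phi t = \sum_(q <- s) q.1 (p t) * q.2 (t.2 * t.1)%g].
pose N := [set phi : G * G -> k | forall g, exists2 u, fil u &
  forall h, phi (g, h) = u h].
have eS : equivariant_submodule p act S.
  split.
  - by exists [::] => t; rewrite big_nil.
  - move=> u v [s uE] [s' vE]; exists (s ++ s') => t.
    by rewrite big_cat -uE -vE.
  - move=> b u [s uE]; exists [seq (b * q.1, q.2) | q : coordRing X * A <- s] => t.
    rewrite big_map; transitivity (b (p t) * u t) => //; rewrite uE mulr_sumr.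
    by apply: eq_bigr => q _; rewrite mulrA.
  - move=> g u [s uE].
    exists [seq (coord_act a g q.1, rt g q.2) | q : coordRing X * A <- s] => t.
    rewrite big_map /translate uE; apply: eq_bigr => q _.
    by rewrite /p /= reg_actM mulgA.
have eN : equivariant_submodule p act N.
  split=> [g|u v Nu Nv g|b u Nu g|g u Nu h].
  - by exists 0 => //; apply: filtered0.
  - have [u' fu uE] := Nu g; have [v' fv vE] := Nv g.
    by exists (u' + v'); [apply: filteredD|move=> h; rewrite coordD -uE -vE].
  - have [u' fu uE] := Nu g; exists (coord_const G (b (p (g, 1%g))) * u').
      exact: filteredM.
    by move=> h; rewrite coordM coordC -uE.
  - exact: (Nu (h * g)%g).
have S_coef u : S u -> exists s : seq (A * (G * G -> k)),
    forall g t, u (act t g) = \sum_(q <- s) q.1 g * q.2 t.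
  move=> [s uE].
  suff [s' s'E] : exists s' : seq (A * (G * G -> k)), forall g t,
    \sum_(q <- s) q.1 (p (act t g)) * q.2 ((act t g).2 * (act t g).1)%g =
    \sum_(q <- s') q.1 g * q.2 t by exists s' => g t; rewrite uE.
  elim: s {u uE} => [|[b v] s [s' IHs]]; first by exists [::] => g t; rewrite !big_nil.
  have [l1 bE] := act_regular a b; have [l2 vE] := @mulg_regular k G v.
  exists ([seq (q.2 * r.2, fun t => q.1 (p t) * r.1 (t.2 * t.1)%g) |
    q : coordRing X * A <- l1, r : A * A <- l2] ++ s') => g t.
  rewrite big_cons IHs big_cat; congr (_ + _).
  rewrite /= {1}/p /= mulgA reg_actM [b _]bE [v _]vE big_allpairs_dep mulr_suml.
  apply: eq_bigr => q _; rewrite mulr_sumr; apply: eq_bigr => r _.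
  by rewrite coordM /=; ring.
have [||||phi [[s phiE] nN phi_fix]] :=
  unipotent_fixed_point (a := a) (p := p) (act := act) _ _ _ eS eN S_coef unip.
- by case=> g h; rewrite /act mulg1.
- by case=> g h u v; rewrite /act mulgA.
- by case=> g h u; rewrite /p /= reg_actM.
- exists (fun t => f (t.2 * t.1)%g); split.
    by exists [:: (1, f)] => t; rewrite big_seq1 mul1r.
  move=> /(_ 1%g)[u fu uE]; apply: nf; rewrite (_ : f = u) //.
  by apply: coordRing_eq => h; rewrite -uE /= mulg1.
(* [w] is the value of [phi] at the identity; as [phi] is fixed modulo [N], all its values equal [w]
   modulo [fil]. *)
pose w : A := \sum_(q <- s) coord_const G (q.1 x) * q.2.
have wE h : w h = phi (1%g, h).
  rewrite coord_sum phiE /p; apply: eq_bigr => q _.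
  by rewrite coordM coordC /= reg_act1 mulg1.
have nw : ~ fil w.
  move=> fw; apply: nN => g; have [u fu uE] := phi_fix g 1%g.
  exists (u + w); first exact: filteredD.
  move=> h; rewrite coordD wE -uE.
  by rewrite [(_ - _) _]/(phi (1%g * g, h)%g - phi (1%g, h)) mul1g subrK.
(* For [h] in the isotropy group the coefficients at [x] do not change, so the value of [phi] at [h]
   is [rt h w]. *)
apply/nw/filtered_step => h hx; have [u fu uE] := phi_fix h 1%g.
rewrite (_ : _ - _ = u) //; apply: coordRing_eq => g.
rewrite -uE coordB wE; congr (_ - _).
rewrite /translate /act /= mul1g phiE /p /= hx coord_sum.
by apply: eq_bigr => q _; rewrite coordM coordC.
Qed.

Theorem isotropy_unipotent : unipotent_action a -> unipotent_subgroup isotropy.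
Proof.
move=> unip g gx f; apply: trivially_filtered_unipotent gx _.
exact: isotropy_trivially_filtered.
Qed.

End Isotropy.

(** * Invariant functions on the group *)

Lemma poly_unique_root (k : closedFieldType) (p : {poly k}) n c :
  p \is monic -> size p = n.+1 -> (forall t, root p t -> t = c) ->
  p = ('X - c%:P) ^+ n.
Proof.
move=> pmon sp pc; have [r rE] := closed_field_poly_normal p.
rewrite (monicP pmon) scale1r in rE.
have sr : size r = n by move: sp; rewrite rE size_prod_XsubC => -[].
have rc : r = nseq n c.
  rewrite -sr; apply/all_pred1P/allP => t tr; apply/eqP/pc.
  by rewrite rE root_prod_XsubC.
rewrite {}rE {}rc; elim: n {sp sr} => [|n IHn]; first by rewrite big_nil.
by rewrite big_cons IHn exprS.
Qed.

(** Raising to the power [q] is additive, so the polynomial is the [m]-th power of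
    ['X^q - (c ^+ q)%:P]. When [m] is invertible, this coefficient recovers [c ^+ q]. *)
Lemma coef_exp_XsubC (k : fieldType) (c : k) q m :
  [pchar k].-nat q -> (0 < m)%N ->
  (('X - c%:P) ^+ (q * m))`_(q * m.-1) = - (m%:R * c ^+ q).
Proof.
move=> pq m0; have q0 : (0 < q)%N by case/andP: pq.
have pq' : [pchar {poly k}].-nat q by rewrite (eq_pnat q (@pchar_poly k)).
rewrite exprM exprDn_pchar // exprNn_pchar // -polyC_exp.
set d := c ^+ q.
have -> : 'X^q - d%:P = ('X - d%:P) \Po 'X^q.
  by rewrite rmorphB /= comp_polyX comp_polyC.
rewrite -rmorphXn /= coef_comp_poly_Xn // dvdn_mulr // mulKn //.
have -> : ('X - d%:P) ^+ m = \prod_(z <- nseq m d) ('X - z%:P).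
  by elim: m {m0} => [|m IHm]; rewrite ?big_nil // exprS big_cons IHm.
rewrite -{2}(size_nseq m d) coefPn_prod_XsubC ?size_nseq -?lt0n //.
congr (- _); elim: m {m0} => [|m IHm]; first by rewrite big_nil mul0r.
by rewrite big_cons IHm mulrS mulrDl mul1r.
Qed.

Lemma comp_XaddC_coef (k : fieldType) (p : {poly k}) c n : (size p <= n.+1)%N ->
  (p \Po ('X + c%:P))`_n = p`_n.
Proof.
rewrite leq_eqVlt ltnS => /predU1P[sp|sp]; last first.
  by rewrite !nth_default // size_comp_poly2 // size_XaddC.
have := @lead_coef_comp _ p ('X + c%:P); rewrite size_XaddC => /(_ isT).
by rewrite lead_coefXaddC expr1n mulr1 !lead_coefE size_comp_poly2 ?size_XaddC // sp.
Qed.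

(** By the Nullstellensatz the ideal of [Z] is [P]. The ideal of a larger irreducible closed set is
    a prime contained in [P], hence equal to [P] by minimality. *)
Lemma minimal_prime_component (k : closedFieldType) (Y : affineVarietyType k)
    (P : set (coordRing Y)) :
  prime_ideal P -> (forall Q, prime_ideal Q -> Q `<=` P -> P `<=` Q) ->
  let Z := [set y | forall f, P f -> f y = 0] in
  irreducible_component Z /\ forall f : coordRing Y,
    (forall y, Z y -> f y = 0) <-> P f.
Proof.
move=> pP Pmin Z.
have IZ (f : coordRing Y) : (forall y, Z y -> f y = 0) <-> P f.
  split=> [fZ|Pf y]; last exact.
  apply: contrapT => nPf.
  have [|y [yP /eqP]] := Nullstellensatz (prime_is_ideal pP) (f := f).
    by move=> n /(primeX pP).
  by apply; apply: fZ.
split=> //; split; first by exists P.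
- split.
    apply/set0P/eqP => Z0; apply: (prime1 pP); by apply/IZ => y; rewrite Z0.
  move=> _ _ [S ->] [S' ->] ZAB; apply: contrapT => /not_orP[].
  move=> /existsNP[y /not_implyP[Zy /existsNP[f /not_implyP[Sf /eqP fy]]]].
  move=> /existsNP[z /not_implyP[Zz /existsNP[f' /not_implyP[Sf' /eqP f'z]]]].
  have : P (f * f').
    apply/IZ => u Zu; rewrite coordM.
    by case: (ZAB u Zu) => /= Au; [rewrite (Au f) // mul0r|rewrite (Au f') // mulr0].
  move=> /(primeM pP)[] /IZ; first by move/(_ _ Zy)/eqP; rewrite (negPf fy).
  by move/(_ _ Zz)/eqP; rewrite (negPf f'z).
- move=> _ [S ->] [[y0 y0S] irr] ZZ'; set Z' := [set _ | _] in irr ZZ' *.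
  pose Q := [set f : coordRing Y | forall y, Z' y -> f y = 0].
  have zQ (f : coordRing Y) : zclosed [set y | f y = 0].
    by exists [set f]; apply/seteqP; split=> y /= => [fy _ ->|] //; apply.
  have pQ : prime_ideal Q.
    split=> [|/(_ y0 y0S)/eqP|f f' ff'].
    + split=> [y _|f f' Qf Qf' y Zy|r f Qf y Zy] //.
        by rewrite coordD Qf // Qf' // addr0.
      by rewrite coordM Qf // mulr0.
    + by rewrite coord1 oner_eq0.
    + apply: irr (zQ f) (zQ f') _ => y /ff' /eqP.
      by rewrite coordM mulf_eq0 => /orP[]/eqP; [left|right].
  have QP : Q `<=` P by move=> f Qf; apply/IZ => y /ZZ'; apply: Qf.
  by move=> y Zy f /(Pmin Q pQ QP); apply.
Qed.

Section Invariants.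
Variables (k : closedFieldType) (G : affineGroupType k).
Variables (X : affineVarietyType k) (a : regular_action G X) (x : X).
Hypothesis unip : unipotent_action a.

Notation A := (coordRing G).
Notation rt := (coord_act (right_mul_action G)).
Notation pb := (pullback a x).

(** These functions are constant on the cosets of the isotropy group that are the fibres of the
    orbit map. *)
Definition invariant : set A :=
  [set f | forall h g, isotropy a x h -> f (h * g)%g = f g].

Let B : set A := [set pb b | b in setT].

Lemma invariant_stable : stable_subalgebra a x invariant.
Proof.
split=> [b h g hx|f f' If If' h g hx|f f' If If' h g hx|g f If h g' hx].
- by rewrite !pullbackE reg_actM (hx : a x h = x).
- by rewrite !coordD If // If'.
- by rewrite !coordM If // If'.
- by rewrite !rtE -mulgA If.
Qed.

Lemma invariant_fiber f g g' : invariant f -> a x g = a x g' -> f g = f g'.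
Proof.
move=> If gg'; rewrite -[g](mulgVK g') If //= /isotropy /=.
by rewrite reg_actM gg' -reg_actM mulgV reg_act1.
Qed.

Definition orbit_function (c : G -> k) := exists b : coordRing X,
  forall g, c g = b (a x g).

Lemma orbit_functionD c d : orbit_function c -> orbit_function d ->
  orbit_function (fun g => c g + d g).
Proof. by move=> [b cE] [b' dE]; exists (b + b') => g; rewrite cE dE. Qed.

Lemma orbit_functionM c d : orbit_function c -> orbit_function d ->
  orbit_function (fun g => c g * d g).
Proof. by move=> [b cE] [b' dE]; exists (b * b') => g; rewrite cE dE. Qed.

Lemma orbit_functionC e : orbit_function (fun=> e).
Proof. by exists (coord_const X e). Qed.

Lemma orbit_functionX c n : orbit_function c -> orbit_function (fun g => c g ^+ n).
Proof. by move=> [b cE]; exists (b ^+ n) => g; rewrite cE coordX. Qed.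

Lemma orbit_function_sum (J : Type) (s : seq J) (c : J -> G -> k) :
  (forall j, orbit_function (c j)) ->
  orbit_function (fun g => \sum_(j <- s) c j g).
Proof.
move=> cP; have /choice[b bE] := cP.
by exists (\sum_(j <- s) b j) => g; rewrite coord_sum; apply: eq_bigr.
Qed.

Lemma orbit_function_ext c d : (forall g, c g = d g) -> orbit_function c ->
  orbit_function d.
Proof. by move=> cd [b cE]; exists b => g; rewrite -cd. Qed.

Lemma orbit_function_shift c h : orbit_function c ->
  orbit_function (fun g => c (g * h)%g).
Proof. by move=> [b cE]; exists (coord_act a h b) => g; rewrite cE reg_actM. Qed.

(* A polynomial with coefficients in [B], given by its values. *)
Definition orbit_poly (Q : G -> {poly k}) :=
  (exists n, forall g, (size (Q g) <= n)%N) /\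
  forall i, orbit_function (fun g => (Q g)`_i).

Lemma orbit_polyD Q Q' : orbit_poly Q -> orbit_poly Q' ->
  orbit_poly (fun g => Q g + Q' g).
Proof.
move=> [[n sQ] QB] [[m sQ'] QB']; split.
  exists (maxn n m) => g; apply: leq_trans (size_polyD _ _) _.
  by rewrite geq_max !leq_max sQ sQ' orbT.
move=> i; apply: orbit_function_ext (orbit_functionD (QB i) (QB' i)) => g.
by rewrite coefD.
Qed.

Lemma orbit_polyM Q Q' : orbit_poly Q -> orbit_poly Q' ->
  orbit_poly (fun g => Q g * Q' g).
Proof.
move=> [[n sQ] QB] [[m sQ'] QB']; split.
  exists (n + m)%N => g; apply: leq_trans (size_polyMleq _ _) _.
  by apply: leq_trans (leq_pred _) _; apply: leq_add.
move=> i; apply: orbit_function_ext (orbit_function_sum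
  (c := fun (j : 'I_i.+1) g => (Q g)`_j * (Q' g)`_(i - j)) _ _) => [g|j].
  by rewrite coefM.
exact: orbit_functionM.
Qed.

Lemma orbit_polyC c : orbit_function c -> orbit_poly (fun g => (c g)%:P).
Proof.
move=> cB; split; first by exists 1%N => g; apply: size_polyC_leq1.
case=> [|i]; first by apply: orbit_function_ext cB => g; rewrite coefC.
by apply: orbit_function_ext (orbit_functionC 0) => g; rewrite coefC.
Qed.

Lemma orbit_poly_const (p : {poly k}) : orbit_poly (fun=> p).
Proof. by split=> [|i]; [exists (size p)|apply: orbit_functionC]. Qed.

Lemma orbit_poly_ext Q Q' : (forall g, Q g = Q' g) -> orbit_poly Q -> orbit_poly Q'.
Proof. by move=> QQ'; rewrite (funext QQ'). Qed.

Lemma orbit_polyX Q n : orbit_poly Q -> orbit_poly (fun g => Q g ^+ n).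
Proof.
move=> QP; elim: n => [|n IHn]; first exact: (orbit_poly_const 1).
by apply: orbit_poly_ext (orbit_polyM QP IHn) => g; rewrite exprS.
Qed.

Lemma orbit_poly_sum (J : Type) (s : seq J) (Q : J -> G -> {poly k}) :
  (forall j, orbit_poly (Q j)) -> orbit_poly (fun g => \sum_(j <- s) Q j g).
Proof.
move=> QP; elim: s => [|j s IHs].
  by apply: orbit_poly_ext (orbit_poly_const 0) => g; rewrite big_nil.
by apply: orbit_poly_ext (orbit_polyD (QP j) IHs) => g; rewrite big_cons.
Qed.

Lemma orbit_poly_comp Q c : orbit_poly Q -> orbit_function c ->
  orbit_poly (fun g => Q g \Po ('X + (c g)%:P)).
Proof.
move=> [[n sQ] QB] cB.
apply: orbit_poly_ext (orbit_poly_sum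
  (Q := fun (i : 'I_n) g => ((Q g)`_i)%:P * ('X + (c g)%:P) ^+ i) _ _) => [g|i].
  have {2}-> : Q g = \poly_(i < n) (Q g)`_i.
    apply/polyP => i; rewrite coef_poly; case: ltnP => // ni.
    by rewrite nth_default // (leq_trans (sQ g)).
  rewrite poly_def linear_sum; apply: eq_bigr => i _ /=.
  by rewrite linearZ /= comp_Xn_poly mul_polyC.
apply: orbit_polyM; first exact: orbit_polyC (QB i).
apply: orbit_polyX; apply: orbit_polyD; first exact: orbit_poly_const.
exact: orbit_polyC.
Qed.

Lemma orbit_poly_shift Q h : orbit_poly Q -> orbit_poly (fun g => Q (g * h)%g).
Proof.
move=> [[n sQ] QB]; split; first by exists n.
by move=> i; apply: (@orbit_function_shift (fun g => (Q g)`_i)).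
Qed.

(** * Adjoining to B an invariant that is fixed modulo B *)

Section Adjoin.
Variable f : A.
Hypotheses (If : invariant f) (nBf : ~ B f).
Hypothesis f_fix : forall g, B (rt g f - f).

(* [B[f]] *)
Let Bf : set A := [set u | exists Q, orbit_poly Q /\ forall g, u g = (Q g).[f g]].

(** Translation by [h] then acts on polynomials in [f] by translating the coefficients and
    substituting ['X + c] for ['X]. *)
Let f_shift h : exists2 c, orbit_function c & forall g, f (g * h)%g = f g + c g.
Proof.
have [b _ bE] := f_fix h; exists (pb b); first by exists b.
by move=> g; rewrite bE coordB rtE addrC subrK.
Qed.

Let Bf_stable : stable_subalgebra a x Bf.
Proof.
split=> [b|u v [Q [QP uE]] [Q' [QP' vE]]|u v [Q [QP uE]] [Q' [QP' vE]]
  |h u [Q [QP uE]]].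
- exists (fun g => (pb b g)%:P); split; last by move=> g; rewrite hornerC.
  by apply: orbit_polyC; exists b.
- exists (fun g => Q g + Q' g); split; first exact: orbit_polyD.
  by move=> g; rewrite hornerD coordD uE vE.
- exists (fun g => Q g * Q' g); split; first exact: orbit_polyM.
  by move=> g; rewrite hornerM coordM uE vE.
- have [c cB fE] := f_shift h.
  exists (fun g => Q (g * h)%g \Po ('X + (c g)%:P)); split.
    by apply: (@orbit_poly_comp (fun g => Q (g * h)%g)) => //; apply: orbit_poly_shift.
  by move=> g; rewrite rtE uE horner_comp fE !hornerE.
Qed.

Definition annihilating (Q : G -> {poly k}) :=
  orbit_poly Q /\ forall g, (Q g).[f g] = 0.

(* [B[f] -> k] is the specialization of [B] at [x g0] and of [f] at [t]; it is a
   point of [G], hence [t = f g0] as [f] is constant on the fibers. *)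
Let common_root g0 t :
  (forall Q, annihilating Q -> (Q g0).[t] = 0) -> t = f g0.
Proof.
move=> tP.
(* A polynomial expressing [u] is specialized at [g0] and evaluated at [t], with the zero polynomial
   as default. Two such polynomials differ by an annihilating one, so [tP] makes the value well
   defined. *)
pose chi (u : A) := (xget (fun=> 0)
  [set Q | orbit_poly Q /\ forall g, u g = (Q g).[f g]] g0).[t].
have chiE (u : A) Q : orbit_poly Q -> (forall g, u g = (Q g).[f g]) ->
    chi u = (Q g0).[t].
  move=> QP uE; rewrite /chi; case: xgetP => [Q' _ [QP' uE']|/(_ Q)[]//].
  apply/subr0_eq; rewrite -hornerN -hornerD.
  apply: (tP (fun g => Q' g - Q g)); split; last first.
    by move=> g; rewrite hornerD hornerN -uE -uE' subrr.
  apply: orbit_polyD => //.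
  apply: orbit_poly_ext (orbit_polyM (orbit_poly_const (-1)) QP) => g.
  by rewrite mulN1r.
have [|||g gE] := character_is_point unip Bf_stable (chi := chi).
- move=> u v [Q [QP uE]] [Q' [QP' vE]].
  rewrite (chiE u Q) // (chiE v Q') // (chiE _ (fun g => Q g + Q' g)) ?hornerD //.
    exact: orbit_polyD.
  by move=> g; rewrite hornerD coordD uE vE.
- move=> u v [Q [QP uE]] [Q' [QP' vE]].
  rewrite (chiE u Q) // (chiE v Q') // (chiE _ (fun g => Q g * Q' g)) ?hornerM //.
    exact: orbit_polyM.
  by move=> g; rewrite hornerM coordM uE vE.
- move=> c; rewrite (chiE _ (fun=> c%:P)) ?hornerC //; first exact: orbit_poly_const.
  by move=> g; rewrite hornerC.
have ft : f g = t.
  have fE g' : f g' = 'X.[f g'] by rewrite hornerX.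
  rewrite -gE; last by exists (fun=> 'X); split=> //; apply: orbit_poly_const.
  by rewrite (chiE _ (fun=> 'X)) ?hornerX //; apply: orbit_poly_const.
rewrite -ft; apply: invariant_fiber => //; apply: regular_separates => b br.
have := gE (pb (CoordRing br)) (salg_pb Bf_stable _).
rewrite (chiE _ (fun g => (pb (CoordRing br) g)%:P)) ?hornerC //.
  by apply: orbit_polyC; exists (CoordRing br).
by move=> g'; rewrite hornerC.
Qed.

Let annihilatingD Q Q' : annihilating Q -> annihilating Q' ->
  annihilating (fun g => Q g + Q' g).
Proof.
move=> [QP Q0] [QP' Q'0]; split; first exact: orbit_polyD.
by move=> g; rewrite hornerD Q0 Q'0 addr0.
Qed.

Let annihilatingM Q Q' : orbit_poly Q' -> annihilating Q ->
  annihilating (fun g => Q' g * Q g).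
Proof.
move=> QP' [QP Q0]; split; first exact: orbit_polyM.
by move=> g; rewrite hornerM Q0 mulr0.
Qed.

Let annihilating_rt Q h : annihilating Q -> exists2 c, orbit_function c &
  annihilating (fun g => Q (g * h)%g \Po ('X + (c g)%:P)).
Proof.
move=> [QP Q0]; have [c cB fE] := f_shift h; exists c => //; split.
  by apply: (@orbit_poly_comp (fun g => Q (g * h)%g)) => //; apply: orbit_poly_shift.
by move=> g; rewrite horner_comp !hornerE -fE Q0.
Qed.

(* The leading coefficients of the annihilating polynomials of minimal degree
   form a stable submodule, which contains 1. *)
Let minimal_poly : exists n mu, [/\ annihilating mu,
  forall g, (mu g \is monic) /\ size (mu g) = n.+1 &
  forall Q, annihilating Q -> (forall g, (size (Q g) <= n)%N) -> forall g, Q g = 0].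
Proof.
have [Q0 [annQ0 [g0 Q0g0]]] : exists Q, annihilating Q /\ exists g, Q g <> 0.
  apply: contrapT => nQ.
  (* If only zero were annihilating, every scalar would satisfy the hypothesis of [common_root]. *)
  have /eqP : f 1%g + 1 = f 1%g.
    apply: common_root => Q annQ; suff -> : Q 1%g = 0 by rewrite horner0.
    by apply: contrapT => Q1; apply: nQ; exists Q; split=> //; exists 1%g.
  by rewrite -subr_eq0 addrC addKr oner_eq0.
pose ok n := exists Q, [/\ annihilating Q, forall g, (size (Q g) <= n)%N &
  exists g, Q g <> 0].
have ex : exists n, `[< ok n >].
  have [n sQ0] := annQ0.1.1; exists n; apply/asboolP; exists Q0; split=> //.
  by exists g0.
case: (ex_minnP ex) => -[|n] /asboolP[Q1 [annQ1 sQ1 [g1 Q1g1]]] nmin.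
  by case: Q1g1; apply/eqP; rewrite -size_poly_leq0.
have small Q : annihilating Q -> (forall g, (size (Q g) <= n)%N) -> forall g, Q g = 0.
  move=> annQ sQ g; apply: contrapT => Qg.
  have /nmin : `[< ok n >] by apply/asboolP; exists Q; split=> //; exists g.
  by rewrite ltnn.
pose I := [set u : A | exists Q, [/\ annihilating Q,
  forall g, (size (Q g) <= n.+1)%N & forall g, u g = (Q g)`_n]].
have sI : stable_submodule a x I.
  split.
  - exists (fun=> 0); split=> [|g|g]; rewrite ?size_poly0 ?coef0 //.
    by split=> [|g]; [apply: orbit_poly_const|rewrite horner0].
  - move=> u v [Q [annQ sQ uE]] [Q' [annQ' sQ' vE]].
    exists (fun g => Q g + Q' g); split; first exact: annihilatingD.
      by move=> g; apply: leq_trans (size_polyD _ _) _; rewrite geq_max sQ sQ'.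
    by move=> g; rewrite coefD coordD uE vE.
  - move=> b u [Q [annQ sQ uE]]; exists (fun g => (pb b g)%:P * Q g); split.
    + by apply: annihilatingM => //; apply: orbit_polyC; exists b.
    + move=> g; rewrite mul_polyC.
      exact: leq_trans (size_scale_leq _ _) (sQ g).
    + by move=> g; rewrite coefCM coordM uE.
  - move=> h u [Q [annQ sQ uE]]; have [c cB annQ'] := annihilating_rt h annQ.
    exists (fun g => Q (g * h)%g \Po ('X + (c g)%:P)); split=> // g.
      by rewrite size_comp_poly2 ?size_XaddC.
    by rewrite rtE uE comp_XaddC_coef.
have [u Iu u0] : exists2 u, I u & u != 0.
  have [b bE] := annQ1.1.2 n; exists (pb b).
    by exists Q1; split=> // g; rewrite bE.
  apply/eqP => b0; apply: Q1g1; apply: small => // g.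
  have Qn : (Q1 g)`_n = 0 by rewrite bE -pullbackE b0.
  have := sQ1 g; rewrite leq_eqVlt ltnS => /predU1P[sQ|//].
  by move: Qn; rewrite -[n]/n.+1.-1 -sQ -lead_coefE => /eqP;
    rewrite lead_coef_eq0 => /eqP Q0'; move: sQ; rewrite Q0' size_poly0.
have [mu [annmu smu mu1]] := stable_submodule1 unip sI Iu u0.
exists n, mu; split=> // g.
have sE : size (mu g) = n.+1.
  apply/eqP; rewrite eqn_leq smu ltnNge; apply/negP => le.
  have := mu1 g; rewrite nth_default // => /eqP; rewrite coord1.
  by rewrite oner_eq0.
by split=> //; apply/monicP; rewrite lead_coefE sE /= -mu1.
Qed.

(** Division by the monic [mu] shows that a root of [mu g] is a root of all annihilating polynomials
    at [g], so [mu g] is a power of ['X - (f g)%:P]. Its degree is [q * m], where [q] is the part at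
    the characteristic (1 in characteristic 0) and [m] is invertible in [k]; a coefficient is then
    [f ^+ q] up to the factor [- m%:R]. *)
Let frobenius_power : exists q, [pchar k].-nat q /\ B (f ^+ q).
Proof.
have [n [mu [annmu mumon small]]] := minimal_poly.
have dvd m Q : annihilating Q -> (forall g, (size (Q g) <= m)%N) ->
    forall g t, root (mu g) t -> (Q g).[t] = 0.
  elim: m Q => [|m IHm] Q annQ sQ g t rt_mu.
    by rewrite (small Q annQ) ?horner0 // => g'; apply: leq_trans (sQ g') _.
  have [mn|nm] := ltnP m n.
    by rewrite (small Q annQ) ?horner0 // => g'; apply: leq_trans (sQ g') _.
  pose D g := (((Q g)`_m)%:P * 'X^(m - n)).
  have DP : orbit_poly D.
    apply: orbit_polyM; last exact: orbit_poly_const.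
    exact: orbit_polyC (annQ.1.2 m).
  (* A multiple of [mu] cancels the term of degree [m]. *)
  have annQ' : annihilating (fun g => Q g + (- 1)%:P * D g * mu g).
    apply: annihilatingD => //.
    apply: (@annihilatingM _ (fun g => (- 1)%:P * D g)) => //.
    by apply: orbit_polyM => //; apply: orbit_poly_const.
  have := IHm _ annQ' _ g t rt_mu.
  rewrite hornerD hornerM (rootP rt_mu) mulr0 addr0; apply=> g'.
  have [mon sz] := mumon g'; apply/leq_sizeP => j mj.
  rewrite /D coefD -!mulrA coefCM mulN1r coefCM coefXnM.
  have -> : (j < m - n)%N = false.
    by apply/negbTE; rewrite -leqNgt (leq_trans _ mj) // leq_subr.
  move: mj; rewrite leq_eqVlt => /predU1P[<-|mj].
    rewrite subKn // -[n in (mu g')`_n]/n.+1.-1 -sz -lead_coefE (monicP mon).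
    by rewrite mulr1 subrr.
  rewrite (nth_default 0 (leq_trans (sQ g') mj)).
  rewrite [(mu g')`_ _]nth_default ?mulr0 ?subrr //.
  by rewrite sz ltn_subRL subnK.
have muE g : mu g = ('X - (f g)%:P) ^+ n.
  have [mon sz] := mumon g; apply: poly_unique_root => // t rt_mu.
  apply: common_root => Q annQ; have [m sQ] := annQ.1.1.
  exact: dvd annQ sQ g t rt_mu.
have n0 : (0 < n)%N.
  rewrite lt0n; apply/eqP => n0; have := annmu.2 1%g.
  by rewrite muE n0 expr0 hornerC => /eqP; rewrite oner_eq0.
pose q := (n`_[pchar k])%N; pose m := (n`_([pchar k]^'))%N.
have nE : n = (q * m)%N by rewrite partnC.
have m0 : m%:R != 0 :> k by rewrite natf_neq0_pchar part_pnat.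
exists q; split; first exact: part_pnat.
have [b bE] := annmu.1.2 (q * m.-1)%N.
exists (coord_const X (- m%:R^-1) * b) => //; apply: coordRing_eq => g.
rewrite pullbackE coordM coordC -bE muE nE coef_exp_XsubC ?part_pnat ?part_gt0 //.
by rewrite coordX mulrNN mulKf.
Qed.

(** Raising to the power [q] is additive, so it maps polynomials in [f] to polynomials in [f ^+ q],
    which lies in [B]. *)
Let Bf_power q u : [pchar k].-nat q -> B (f ^+ q) -> Bf u -> B (u ^+ q).
Proof.
move=> pq [b _ bE] [Q [[[n sQ] QB] uE]].
have [c cE] : orbit_function (fun g => u g ^+ q).
  apply: orbit_function_ext (orbit_function_sum
    (c := fun (i : 'I_n) g => (Q g)`_i ^+ q * (pb b g) ^+ i) _ _) => [g|i].
    rewrite uE (horner_coef_wide _ (sQ g)).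
    rewrite (big_morph (fun t => t ^+ q) (id1 := 0) (op1 := +%R)).
    - apply: eq_bigr => i _; rewrite exprMn bE coordX -!exprM.
      by rewrite mulnC.
    - by move=> s t; apply: exprDn_pchar.
    - by rewrite expr0n; case/andP: pq; case: (q).
  apply: orbit_functionM; first exact: orbit_functionX (QB i).
  by apply: orbit_functionX; exists b.
by exists c => //; apply: coordRing_eq => g; rewrite coordX cE.
Qed.

(** The [d] in [B] with [d * f] in [B] form a stable submodule; if it were nonzero it would contain
    1, and [f] would lie in [B]. *)
Let B_ann d : B d -> B (d * f) -> d = 0.
Proof.
have sB := pullback_stable a x.
move=> Bd Bdf; apply/eqP; apply: contraT => d0; exfalso; apply: nBf.
pose I := [set d | B d /\ B (d * f)].
suff : I 1 by rewrite /I /= mul1r => -[].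
apply: (stable_submodule1 unip _ _ d0) => //; split.
- by split; [apply: salg0 sB|rewrite mul0r; apply: salg0 sB].
- move=> u v [Bu Buf] [Bv Bvf]; split; first exact: salgD sB _ _ _ _.
  by rewrite mulrDl; apply: salgD sB _ _ _ _.
- move=> b u [Bu Buf]; have Bb := salg_pb sB b.
  by split; rewrite -?mulrA; apply: salgM sB _ _ _ _.
- move=> g u [Bu Buf]; split; first exact: salg_rt sB _ _ _.
  have -> : rt g u * f = rt g (u * f) - rt g u * (rt g f - f).
    by rewrite rtM; ring.
  apply: (salgB sB); first exact: salg_rt sB _ _ _.
  by apply: (salgM sB); [apply: salg_rt sB _ _ _|apply: f_fix].
Qed.

(** In the function field of a component of [G], 1 and [f] are independent over the pullback field.
    Separability would preserve this for their [q]-th powers, whereas [f ^+ q] lies in [B]. *)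
Lemma adjoin_not_separable : ~ separable_map (orbit_map_regular a x).
Proof.
have [q [pq Bfq]] := frobenius_power; move=> sep.
have q0 : (0 < q)%N by case/andP: pq.
(* A minimal prime below the ideal of the identity of [G] provides the component. *)
pose P0 := [set u : A | u 1%g = 0].
have pP0 : prime_ideal P0.
  split=> [|/eqP|u v /eqP].
  - split=> [//|u v /= u0 v0|r u /= u0]; rewrite /P0 /mkset.
      by rewrite coordD u0 v0 addr0.
    by rewrite coordM u0 mulr0.
  - by rewrite coord1 oner_eq0.
  - by rewrite coordM mulf_eq0 => /orP[]/eqP; [left|right].
have [P [pP _ Pmin]] := exists_minimal_prime pP0.
have iP := prime_is_ideal pP.
have [Zcomp IZ] := minimal_prime_component pP Pmin.
have [K [i [[iker _] sepK]]] := sep _ Zcomp.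
have iP0 u : i u = 0 <-> P u by rewrite iker IZ.
set F := pullback_field _ _ in sepK.
have pbE b : comorphism (orbit_map_regular a x) b = pb b by [].
have FB b : F (i (pb b)).
  exists b, 1; rewrite !pbE (_ : pb 1 = 1); last exact: val_inj.
  by rewrite rmorph1 divr1 oner_eq0.
have indep0 : independent_over F (fun j : 'I_2 => if j == ord0 then 1 else i f).
  move=> c cF; rewrite !big_ord_recl big_ord0 /= mulr1 addr0 => sum0.
  suff c1 : c (lift ord0 ord0) = 0.
    move: sum0; rewrite c1 mul0r addr0 => c0 j.
    by case: (unliftP ord0 j) => [j' ->|-> //]; rewrite (ord1 j').
  apply/eqP; apply: contraT => c1n0; exfalso.
  have [b0 [d0 [d0n0 c0E]]] := cF ord0.
  have [b1 [d1 [d1n0 c1E]]] := cF (lift ord0 ord0).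
  rewrite !pbE in d0n0 c0E d1n0 c1E.
  have b1n0 : i (pb b1) != 0.
    by apply: contraNneq c1n0 => b10; rewrite c1E b10 mul0r.
  (* Cleared of denominators, a relation says that [e0 + e1 * f] lies in [P], so some [w] outside
     [P] kills it. By freeness over [B[f]] the coordinates of [w] kill it too, and one of them is
     outside [P]; its [q]-th power is in [B], which allows [B_ann]. *)
  pose e0 := pb (b0 * d1); pose e1 := pb (b1 * d0).
  have Pr : P (e0 + e1 * f).
    apply/iP0; rewrite /e0 /e1 !pullbackM rmorphD !rmorphM /=.
    apply: (mulfI (invr_neq0 (mulf_neq0 d0n0 d1n0))).
    rewrite mulr0 -[RHS]sum0 c0E c1E; field.
    by rewrite d0n0 d1n0.
  have nPe1 : ~ P e1.
    by rewrite /e1 pullbackM => /(primeM pP)[] /iP0 /eqP; apply/negP.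
  have [w [nPw wr]] := minimal_prime_annihilator (@coord_reduced _ _) pP Pmin Pr.
  have [E [_ frE Espan]] := stable_subalgebra_basis unip Bf_stable.
  have [s [c' [us sE c'S wE]]] := span_uniq (salg0 Bf_stable)
    (fun u v => salgD Bf_stable (f := u) (h := v)) (Espan w).
  have Bfr : Bf (e0 + e1 * f).
    apply: (salgD Bf_stable); first exact: salg_pb.
    apply: (salgM Bf_stable); first exact: salg_pb.
    exists (fun=> 'X); split; first exact: orbit_poly_const.
    by move=> g; rewrite hornerX.
  have c'r e : e \in s -> c' e * (e0 + e1 * f) = 0.
    apply: (frE s (fun e => c' e * (e0 + e1 * f))) => // [e'|].
      exact: salgM Bf_stable _ _ _ _.
    rewrite -[RHS]wr wE mulr_suml; apply: eq_bigr => e' _.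
    by rewrite mulrAC.
  have [e [es nPe]] : exists e, e \in s /\ ~ P (c' e).
    apply: contrapT => nP; apply: nPw; rewrite wE big_seq.
    elim/big_ind: _ => [|u v|e es]; [exact: ideal0|exact: idealD|].
    rewrite mulrC; apply: idealM => //; apply: contrapT => nPe.
    by apply: nP; exists e.
  have Bs := Bf_power pq Bfq (c'S e).
  have sB := pullback_stable a x.
  have Be0 : B e0 := salg_pb sB _.
  have Be1 : B e1 := salg_pb sB _.
  have sr : c' e ^+ q * e0 + c' e ^+ q * e1 * f = 0.
    transitivity (c' e ^+ q.-1 * (c' e * (e0 + e1 * f))).
      by rewrite -[in LHS](prednK q0) exprSr; ring.
    by rewrite c'r // mulr0.
  have : P (c' e ^+ q * e1).
    rewrite (B_ann (d := c' e ^+ q * e1)); first exact: ideal0.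
      exact: salgM sB _ _ _ _.
    move: sr => /eqP; rewrite addrC addr_eq0 => /eqP ->.
    rewrite -sub0r; apply: (salgB sB); first exact: salg0 sB.
    exact: salgM sB _ _ _ _.
  by move=> /(primeM pP)[/(primeX pP)|].
have indepq : independent_over F
    (fun j : 'I_2 => (if j == ord0 then 1 else i f) ^+ q).
  have [->|q1] := eqVneq q 1%N.
    by move=> c cF sum0; apply: indep0 cF _; rewrite -[RHS]sum0;
      apply: eq_bigr => j _; rewrite expr1.
  have q2 : (1 < q)%N by rewrite ltn_neqAle eq_sym q1.
  have pk : pdiv q \in [pchar k].
    move: pq => /andP[_ /allP]; apply.
    by rewrite mem_primes pdiv_prime // pdiv_dvd q0.
  have pK : pdiv q \in [pchar K].
    by rewrite (rmorph_pchar (i \o coord_const G : {rmorphism k -> K}) pk).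
  have : (pdiv q).-nat q by rewrite -(eq_pnat q (pcharf_eq pk)).
  move=> /p_natP[e ->]; elim: e => [|e IHe].
    by move=> c cF sum0; apply: indep0 cF _; rewrite -[RHS]sum0;
      apply: eq_bigr => j _; rewrite expr1.
  (* [q] is a power of the characteristic [pdiv q]; each factor uses separability once. *)
  have := sepK _ pK _ _ IHe.
  rewrite (_ : (fun j => _) = (fun j : 'I_2 =>
    (if j == ord0 then 1 else i f) ^+ (pdiv q ^ e.+1))) //.
  by apply/funext => j; rewrite -exprM expnSr.
have [b _ bE] := Bfq.
pose c (j : 'I_2) := if j == ord0 then - i (f ^+ q) else 1.
have cF j : F (c j).
  rewrite /c; case: ifP => _; last first.
    by rewrite -(rmorph1 i) (_ : 1 = pb 1) //; apply: val_inj.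
  by rewrite -rmorphN -bE (_ : - pb b = pb (- b)) //; apply: val_inj.
have sum0 : \sum_j c j * (if j == ord0 then 1 else i f) ^+ q = 0.
  by rewrite /c !big_ord_recl big_ord0 /= expr1n mulr1 mul1r addr0 rmorphXn addNr.
by have /eqP := indepq c cF sum0 (lift ord0 ord0); rewrite /c /= oner_eq0.
Qed.

End Adjoin.

(** If the invariants were more than [B], their quotient by [B] would have a fixed point, contrary
    to [adjoin_not_separable]. *)
Theorem invariant_is_pullback f : separable_map (orbit_map_regular a x) ->
  invariant f -> exists b, pb b = f.
Proof.
move=> sep If; apply: contrapT => nBf.
have [|u [Iu nBu u_fix]] := stable_fixed_point unip
    (salg_submodule invariant_stable) (salg_submodule (pullback_stable a x)).
  by exists f; split=> // -[b _ bf]; apply: nBf; exists b.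
exact: adjoin_not_separable Iu nBu u_fix sep.
Qed.

End Invariants.

(** * The orbit as a homogeneous space *)

(** In the binomial expansion of exponent [N1 + N2], each term has a factor in [I]. The point is
    that [N] does not depend on [c]. *)
Lemma ideal_power_combination (R : comPzRingType) (I : set R) n (u : 'I_n -> R) :
  ideal I -> (forall i, exists N, I (u i ^+ N)) ->
  exists N, forall c : 'I_n -> R, I ((\sum_i c i * u i) ^+ N).
Proof.
move=> iI; elim: n u => [|n IHn] u uI.
  by exists 1%N => c; rewrite big_ord0 expr1; apply: ideal0.
have [N1 IN1] := uI ord0.
have [|N2 IN2] := IHn (fun i => u (lift ord0 i)); first by move=> i; apply: uI.
exists (N1 + N2)%N => c; rewrite big_ord_recl; set v := \sum_(i < n) _.
rewrite exprDn; apply: ideal_sum => // i.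
rewrite -mulr_natl; apply: idealM => //.
move: (nat_of_ord i) => {}i; have [iN|Ni] := leqP i N2.
  rewrite addnC -addnBAC // exprD [(_ * _) ^+ N1]exprMn.
  have -> (w y z t : R) : w * (y * z) * t = (w * y * t) * z by ring.
  exact: idealM.
apply: idealM => //; rewrite -(subnK (ltnW Ni)) exprD; apply: idealM => //.
exact: IN2.
Qed.

(** * Zariski open sets and regular functions on principal ones *)

Section OpenSets.
Variables (k : closedFieldType) (Y : affineVarietyType k).

Lemma zclosedU (C D : set Y) : zclosed C -> zclosed D -> zclosed (C `|` D).
Proof.
move=> [S ->] [S' ->].
exists [set f | exists g h, [/\ S g, S' h & f = g * h]]; apply/seteqP; split=> y /=.
  by move=> [yS|yS] _ [g [h [Sg Sh ->]]]; rewrite coordM;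
    [rewrite yS // mul0r|rewrite (yS h) // mulr0].
move=> yP; apply: contrapT => /not_orP[].
move=> /existsNP[g /not_implyP[Sg /eqP gy]] /existsNP[h /not_implyP[Sh /eqP hy]].
have /eqP : (g * h) y = 0 by apply: yP; exists g, h.
by rewrite coordM mulf_eq0 (negPf gy) (negPf hy).
Qed.

Lemma zopenI (U V : set Y) : zopen U -> zopen V -> zopen (U `&` V).
Proof. by rewrite /zopen setCI; apply: zclosedU. Qed.

Lemma zopenP (U : set Y) : zopen U <-> exists S : set (coordRing Y),
  U = [set y | exists2 f, S f & f y != 0].
Proof.
split=> -[S US]; exists S; last first.
  rewrite US; apply/seteqP; split=> y /=.
    by move=> nS f Sf; apply: contrapT => /eqP fy; apply: nS; exists f.
  by move=> yS [f /yS ->]; rewrite eqxx.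
rewrite -(setCK U) US; apply/seteqP; split=> y /=.
  by move=> /existsNP[f /not_implyP[Sf /eqP fy]]; exists f.
by move=> [f Sf /eqP fy] /(_ f Sf).
Qed.

Lemma zopen_principal (f : coordRing Y) : zopen [set y | f y != 0].
Proof.
apply/zopenP; exists [set f]; apply/seteqP; split=> y /=; first by exists f.
by move=> [_ ->].
Qed.

(* A locally regular function on the principal open set of [b] lies in
   [k[Y][1/b]]: its denominators form an ideal without zeros there. *)
Lemma regular_principal_open (b : coordRing Y) (f : Y -> k) :
  (forall y, b y != 0 -> exists (W : set Y) (u v : coordRing Y), [/\ zopen W, W y &
     forall z, W z -> v z != 0 /\ f z = u z / v z]) ->
  exists n (u : coordRing Y), forall y, u y = b y ^+ n.+1 * f y.
Proof.
move=> f_reg.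
(* The factor [b] makes the product independent of the values of [f] outside the principal open set,
   and accounts for [n.+1] in the conclusion. *)
pose I := [set w : coordRing Y | exists u : coordRing Y,
  forall y, u y = w y * b y * f y].
have iI : ideal I.
  split=> [|w w' [u uE] [u' u'E]|r w [u uE]].
  - by exists 0 => y; rewrite !coord0 !mul0r.
  - by exists (u + u') => y; rewrite !coordD uE u'E !mulrDl.
  - by exists (r * u) => y; rewrite !coordM uE !mulrA.
suff [n [u uE]] : exists n, I (b ^+ n).
  by exists n, u => y; rewrite uE coordX exprSr.
apply: contrapT => nI.
have [|y [yI by0]] := Nullstellensatz iI (f := b).
  by move=> n In; apply: nI; exists n.
have [W [u [v [/zopenP[S ->] [t St ty] Wf]]]] := f_reg y by0.
have : I (t * v).
  exists (t * b * u) => z; rewrite !coordM.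
  have [->|tz] := eqVneq (t z) 0; first by rewrite !mul0r.
  have [|vz ->] := Wf z; first by exists t.
  by field.
move/yI; rewrite coordM => /eqP; rewrite mulf_eq0 (negPf ty) /=.
by have [|/negPf->] := Wf y _; first by exists t.
Qed.

End OpenSets.

Lemma zopen_preimage (k : closedFieldType) (Y Z : affineVarietyType k)
    (phi : Y -> Z) (U : set Z) :
  regular_map phi -> zopen U -> zopen (phi @^-1` U).
Proof.
move=> rphi /zopenP[S ->]; apply/zopenP.
exists [set comorphism rphi f | f in S]; apply/seteqP; split=> y /=.
  by move=> [f Sf fy]; exists (comorphism rphi f) => //; exists f.
by move=> [_ [f Sf <-] fy]; exists f.
Qed.

(** * The isomorphism between the coset space and the orbit *)

Section OrbitSpace.
Variables (k : closedFieldType) (G : affineGroupType k).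
Variables (X : affineVarietyType k) (a : regular_action G X) (x : X).
Hypothesis unip : unipotent_action a.

Notation A := (coordRing G).
Notation rt := (coord_act (right_mul_action G)).
Notation pb := (pullback a x).
Notation H := (isotropy a x).
Let B : set A := [set pb b | b in setT].
Let sB : stable_subalgebra a x B := pullback_stable a x.

(* The fibre through [g] has ideal [(c in B, c g = 0)] up to radical, with an
   exponent that can be chosen uniformly in [g] because the translates of [s]
   span a finite dimensional space.  Hence [s] vanishes on it if and only if the
   coordinates of [s ^+ N] in a basis of [k[G]] over [B] vanish at [g]. *)
Lemma orbit_map_open (s : A) : exists D : set (coordRing X), forall g,
  (exists g', a x g' = a x g /\ s g' != 0) <-> (exists2 b, D b & b (a x g) != 0).
Proof.
pose M g := [set c : A | B c /\ c g = 0].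
have M0 g : M g 0 by split; [apply: salg0 sB|].
have MD g c d : M g c -> M g d -> M g (c + d).
  move=> [Bc c0] [Bd d0]; split; first exact: salgD sB _ _ _ _.
  by rewrite coordD c0 d0 addr0.
have MB g c d : M g c -> B d -> M g (c * d).
  move=> [Bc c0] Bd; split; first exact: salgM sB _ _ _ _.
  by rewrite coordM c0 mul0r.
(* For [g] in [T], [s] vanishes on the whole fibre through [g]. Translating by [g] moves this fibre
   to the isotropy group, which is the zero set of [M 1]. *)
pose T := [set g | forall h, H h -> s (h * g)%g = 0].
have [N TN] : exists N, forall g, T g -> span_over (M 1%g) setT (rt g s ^+ N).
  have [l lE] := @mulg_regular k G s.
  have [|n [z [r [Tz rE]]]] := @finite_coefficients k G (G -> k^o) T
      [seq (q.2, val q.1) | q : A * A <- l] (fun g => val (rt g s)).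
    move=> g _; apply/funext => h; rewrite big_map fct_sumE [LHS]lE.
    by apply: eq_bigr => q _; rewrite mulrC.
  have [|N NE] := @ideal_power_combination _ _ n (fun i => rt (z i) s)
    (span_ideal (M 1%g)).
    move=> i; apply: contrapT => nN.
    have [|g [gM /eqP]] := Nullstellensatz (span_ideal (M 1%g)) (f := rt (z i) s).
      by move=> N IN; apply: nN; exists N.
    apply; rewrite rtE; apply: (Tz i); apply: regular_separates => b br.
    apply/subr0_eq; pose b' := CoordRing br.
    rewrite -[LHS]/((pb b' - coord_const G (b x)) g); apply: gM.
    rewrite -[_ - _]mulr1; apply: span_gen => //; split.
      by apply: (salgB sB); [apply: salg_pb sB _|apply: salgC sB].
    by rewrite coordB pullbackE reg_act1 coordC subrr.
  exists N => g Tg.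
  rewrite (_ : rt g s = \sum_i coord_const G (r i g) * rt (z i) s) //.
  apply: val_inj; rewrite rE // raddf_sum; apply: eq_bigr => i _.
  by apply/funext.
have [E [_ frE Espan]] := stable_subalgebra_basis unip sB.
have [t [c [ut tE cB sE]]] := span_uniq (salg0 sB)
  (fun u v => salgD sB (f := u) (h := v)) (Espan (s ^+ N)).
exists [set b | exists2 e, e \in t & pb b = c e] => g; split.
  move=> [g' [gg' sg']]; apply: contrapT => nD; case/eqP: sg'.
  have /eqP : (s ^+ N) g' = 0.
    rewrite sE coord_sum big_seq big1 // => e et.
    have [b _ bE] := cB e; rewrite coordM -bE pullbackE gg'.
    have [->|b0] := eqVneq (b (a x g)) 0; first by rewrite mul0r.
    by case: nD; exists b => //; exists e.
  by rewrite coordX expf_eq0 => /andP[_ /eqP].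
move=> [b [e et bE] bg]; apply: contrapT => ns; case/eqP: bg.
have Tg : T g.
  move=> h hx; apply: contrapT => /eqP sn0; apply: ns; exists (h * g)%g.
  by rewrite reg_actM (hx : a x h = x).
rewrite -pullbackE bE.
suff [] : M g (c e) by [].
apply: (free_coordinates (D := B) (E := E) (s := t) (salg0 sB) _ frE
  (M0 g) (@MD g)) => //.
- by move=> u v; apply: salgB sB.
- by move=> u [].
- rewrite -sE; apply: (span_basis (MB g) Espan).
  (* Translation by the inverse of [g] carries [M 1] to [M g]. *)
  have -> : s ^+ N = rt g^-1%g (rt g s ^+ N).
    by apply: coordRing_eq => h; rewrite rtE !coordX rtE mulgVK.
  move: (TN g Tg); move: (_ ^+ N).
  apply: (@span_ind _ _ _ (fun f => span_over (M g) setT (rt g^-1%g f))).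
  + by rewrite (_ : rt _ 0 = 0); [apply: span0|apply: val_inj].
  + by move=> f h; rewrite rtD; apply: spanD.
  + move=> d f [Bd d1] _; rewrite rtM; apply: span_gen => //.
    by split; [apply: salg_rt sB _ _ _|rewrite rtE mulgV].
Qed.

Lemma coset_projP g g' : coset_proj H g = coset_proj H g' <-> a x g = a x g'.
Proof.
split=> [/(congr1 sval)/= gg'|gg'].
  have : right_coset H g' g.
    rewrite -gg'; exists 1%g; rewrite ?mul1g //.
    exact: reg_act1.
  by move=> [h hx <-]; rewrite reg_actM (hx : a x h = x).
apply: eq_exist; apply/seteqP; split=> _ [h hx <-].
  exists (h * (g * g'^-1))%g; last by rewrite -mulgA mulgVK.
  by rewrite /isotropy /= !reg_actM (hx : a x h = x) gg' -reg_actM mulgV reg_act1.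
exists (h * (g' * g^-1))%g; last by rewrite -mulgA mulgVK.
by rewrite /isotropy /= !reg_actM (hx : a x h = x) -gg' -reg_actM mulgV reg_act1.
Qed.

Lemma coset_space_proj (z : coset_space H) : exists g, z = coset_proj H g.
Proof. by case: z => C [g gE]; exists g; apply: eq_exist. Qed.

Let rep (z : coset_space H) : G := sval (cid (coset_space_proj z)).
Let repE z : coset_proj H (rep z) = z.
Proof. by rewrite /rep; case: cid. Qed.

Definition coset_to_orbit (z : homogeneous_space H) : orbit_space a x :=
  exist _ (a x (rep z)) (ex_intro2 _ _ (rep z) I erefl).

Definition orbit_to_coset (y : orbit_space a x) : homogeneous_space H :=
  coset_proj H (s2val (cid2 (svalP y))).

Lemma coset_to_orbitE g : sval (coset_to_orbit (coset_proj H g)) = a x g.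
Proof. by apply/coset_projP; rewrite repE. Qed.

Lemma orbit_to_cosetE (y : orbit_space a x) g :
  sval y = a x g -> orbit_to_coset y = coset_proj H g.
Proof. by rewrite /orbit_to_coset; case: cid2 => g' /= _ <- /coset_projP. Qed.

Lemma coset_to_orbitK : cancel coset_to_orbit orbit_to_coset.
Proof.
move=> z; have [g ->] := coset_space_proj z.
by apply: orbit_to_cosetE; rewrite coset_to_orbitE.
Qed.

Lemma orbit_to_cosetK : cancel orbit_to_coset coset_to_orbit.
Proof.
move=> y; have [g _ gy] := svalP y.
rewrite (orbit_to_cosetE (esym gy)); case: y gy => y Oy /= gy.
by apply: eq_exist; rewrite -gy -[RHS]coset_to_orbitE.
Qed.

Lemma coset_to_orbit_morphism : space_morphism coset_to_orbit.
Proof.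
move=> V [V0 oV0 VE].
have preE : coset_proj H @^-1` (coset_to_orbit @^-1` V) = a x @^-1` V0.
  by rewrite VE; apply/funext => g; apply: congr1 (coset_to_orbitE g).
have oP U : zopen U -> zopen (a x @^-1` U).
  exact: zopen_preimage (orbit_map_regular a x).
split=> [|f f_reg g Vg]; first by rewrite /= preE; apply: oP.
have [V1 [h [oV1 V1g h_reg fh]]] := f_reg _ Vg.
have [V2 [u [v [oV2 V2g V21 hE]]]] := h_reg _ V1g.
exists (a x @^-1` V2 `&` a x @^-1` V0), (pb u), (pb v); split.
- by apply: zopenI; apply: oP.
- by split; [move: V2g; rewrite coset_to_orbitE|rewrite -preE].
- by move=> g' [_]; rewrite -preE.
- move=> g' [V2g' V0g']; have [vn0 hg'] := hE _ V2g'.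
  rewrite -preE in V0g'; split=> //; rewrite -[RHS]hg' -(coset_to_orbitE g').
  by apply: fh => //; rewrite coset_to_orbitE; apply: V21.
Qed.

Hypothesis sep : separable_map (orbit_map_regular a x).

(** Openness is [orbit_map_open], applied to each function of a family defining the open set. On the
    principal open set of [pb b], a regular function on cosets is a fraction whose numerator is
    invariant under the isotropy group, hence a pullback. *)
Lemma orbit_to_coset_morphism : space_morphism orbit_to_coset.
Proof.
move=> U /zopenP[S US].
have UP g : U (coset_proj H g) <-> exists2 s, S s & s g != 0.
  by rewrite -[U _]/((coset_proj H @^-1` U) g) US.
have /choice[D DP] := orbit_map_open.
pose D' := [set b | exists2 s, S s & D s b].
have UD g : U (coset_proj H g) <-> exists2 b, D' b & b (a x g) != 0.
  split=> [/UP[s Ss sg]|[b [s Ss Dsb] bg]].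
    have [b Db bg] : exists2 b, D s b & b (a x g) != 0 by apply/DP; exists g.
    by exists b => //; exists s.
  have [g' [gg' sg']] : exists g', a x g' = a x g /\ s g' != 0.
    by apply/DP; exists b.
  by have /coset_projP <- := gg'; apply/UP; exists s.
split=> [|f f_reg y Uy].
  exists [set y | exists2 b, D' b & b y != 0]; first by apply/zopenP; exists D'.
  apply/seteqP; split=> y /=; have [g _ gy] := svalP y;
    by rewrite (orbit_to_cosetE (esym gy)) -gy => /UD.
have [g _ gy] := svalP y.
have [b D'b bg] : exists2 b, D' b & b (a x g) != 0.
  by apply/UD; rewrite -(orbit_to_cosetE (esym gy)).
have [|n [u uE]] := @regular_principal_open _ _ (pb b) (f \o coset_proj H).
  move=> g' bg'; have /f_reg : (coset_proj H @^-1` U) g' by apply/UD; exists b.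
  by move=> [W [u [v [oW Wg' _ WE]]]]; exists W, u, v.
have [u0 u0E] : exists u0, pb u0 = u.
  apply: invariant_is_pullback => // h g' hx; rewrite !uE !pullbackE /comp.
  have E : a x (h * g')%g = a x g' by rewrite reg_actM (hx : a x h = x).
  by rewrite E; have /coset_projP -> := E.
have bX y' : b y' != 0 -> (b ^+ n.+1) y' != 0 by rewrite coordX; apply: expf_neq0.
exists [set y' | b y' != 0], (fun y' => u0 y' / (b ^+ n.+1) y'); split.
- exact: zopen_principal.
- by rewrite -gy.
- move=> y' by'; exists [set y' | b y' != 0], u0, (b ^+ n.+1).
  by split=> //; [apply: zopen_principal|move=> z bz; split=> //; apply: bX].
- move=> w Uw bw; have [g' _ gw] := svalP w.
  rewrite /= (orbit_to_cosetE (esym gw)) -gw -pullbackE u0E uE pullbackE coordX.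
  by rewrite -gw in bw; rewrite [_ * (f \o _) _]mulrC mulfK // expf_neq0.
Qed.

Theorem orbit_homogeneous : orbit_iso_homogeneous a x H.
Proof.
exists coset_to_orbit; split; last by move=> g b; rewrite !coset_to_orbitE reg_actM.
exists orbit_to_coset; split; [exact: coset_to_orbitK|exact: orbit_to_cosetK| |].
  exact: coset_to_orbit_morphism.
exact: orbit_to_coset_morphism.
Qed.

End OrbitSpace.

Theorem theorem7p5 (k : closedFieldType) (G : affineGroupType k)
    (X : affineVarietyType k) (a : regular_action G X) :
  unipotent_action a ->
  (forall x : X, zclosed (action_orbit a x)) /\
  (separable_action a ->
   forall x : X, exists H : set G,
     [/\ closed_subgroup H, unipotent_subgroup H & orbit_iso_homogeneous a x H]).
Proof.
move=> unip; split=> [x|sep x]; first exact: unipotent_orbit_closed.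
exists (isotropy a x); split.
- exact: isotropy_closed_subgroup.
- exact: isotropy_unipotent.
- exact: orbit_homogeneous.
Qed.
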